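(* Let $X=\{X_t\}_{0\le t\le T}$ be the $\mathcal{S}_{-p}$-valued process which is a (global) strong solution of $$dX_t=L(X_t)\,dt+A(X_t)\cdot dB_t,\qquad X_0=\phi,$$ the equation holding in $\mathcal{S}_{-p-1}$, and suppose that $$\mathbb{E}\left[\exp\left(\sum_{j=1}^d\left\{\int_0^T\sqrt{\mathbb{E}\|X_s\|_{-p-1}^2}\,dB^j_s-\frac12\int_0^T\mathbb{E}\|X_s\|_{-p-1}^2\,ds\right\}\right)\right]=1.$$ Define the measure $Q$ on $(\Omega,\mathcal{F})$ by $$dQ(\omega)=\exp\left(\sum_{j=1}^d\left\{\int_0^T\sqrt{\mathbb{E}\|X_s\|_{-p-1}^2}\,dB^j_s-\frac12\int_0^T\mathbb{E}\|X_s\|_{-p-1}^2\,ds\right\}\right)dP(\omega).$$ Then the process $\widehat B=(\widehat B^1,\dots,\widehat B^d)$ given by $$\widehat B^j_t=B^j_t-\int_0^t\sqrt{\mathbb{E}\|X_s\|_{-p-1}^2}\,ds,\qquad t\in[0,T],\ j=1,\dots,d,$$ is a ($d$-dimensional standard) Brownian motion with respect to $Q$ on the probability space $(\Omega,\mathcal{F},Q)$.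
   Context: Fix $T>0$, $d\ge1$, and a complete filtered probability space $(\Omega,\mathcal{F},\{\mathcal{F}_t\}_{t\in[0,T]},P)$ satisfying the usual conditions, with a $d$-dimensional standard $\{\mathcal{F}_t\}$-Brownian motion $B=(B^1,\dots,B^d)$. $\mathbb{E}$ denotes expectation under $P$. Hermite-Sobolev spaces: $\mathcal{S}$ is the real Schwartz space on $\mathbb{R}^d$ and $\mathcal{S}'$ its dual. For $q\in\mathbb{R}$, $\mathcal{S}_q$ is the completion of $\mathcal{S}$ in the norm $\|\cdot\|_q$ of the inner product $\langle f,g\rangle_q=\sum_{n\in\mathbb{Z}_+^d}(2|n|+d)^{2q}\langle f,h_n\rangle\langle g,h_n\rangle$, where $\{h_n\}$ is the orthonormal basis of $L^2(\mathbb{R}^d)$ of Hermite functions, $\mathbb{Z}_+^d$ is the set of multi-indices of non-negative integers, $|n|=n_1+\cdots+n_d$, and $\langle\cdot,\cdot\rangle$ is the $L^2$ inner product. For $q\ge 0$ the dual of $\mathcal{S}_q$ is identified with $\mathcal{S}_{-q}$, and $\mathcal{S}'=\bigcup_{q\ge0}\mathcal{S}_{-q}$. The distributional derivatives $\partial_i:\mathcal{S}_q\to\mathcal{S}_{q-1/2}$ and $\partial_{ij}^2:\mathcal{S}_q\to\mathcal{S}_{q-1}$ are bounded. For $x\in\mathbb{R}^d$, the translation $\tau_x$ is $(\tau_x\psi)(z)=\psi(z-x)$ on $\mathcal{S}$, extended to $\mathcal{S}'$ by $\langle\tau_x\psi_1,\psi_2\rangle=\langle\psi_1,\tau_{-x}\psi_2\rangle$.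 Coefficients: $\phi\in\mathcal{S}'$ is deterministic, and $p\ge0$ is fixed with $\phi\in\mathcal{S}_{-p}$. Let $\sigma_{ij},b_i\in\mathcal{S}_p$ for $i,j=1,\dots,d$, regarded through the duality of $\mathcal{S}_p$ and $\mathcal{S}_{-p}$ as continuous linear functionals $y\mapsto\sigma_{ij}(y)$, $y\mapsto b_i(y)$ on $\mathcal{S}_{-p}$; $\sigma=(\sigma_{ij})$. For $y\in\mathcal{S}_{-p}$ put $$L(y)=\tfrac12\sum_{i,j=1}^d(\sigma(y)\sigma^t(y))_{ij}\,\partial^2_{ij}y-\sum_{i=1}^d b_i(y)\,\partial_i y,\qquad A_j(y)=-\sum_{i=1}^d\sigma_{ij}(y)\,\partial_i y,\qquad A=(A_1,\dots,A_d),$$ with values in $\mathcal{S}_{-p-1}$; $A(y)\cdot dB=\sum_j A_j(y)\,dB^j$. For $\rho\in\mathbb{R}^d$ put $\bar\sigma_{ij}(\rho)=\sigma_{ij}(\tau_\rho\phi)$, $\bar b_i(\rho)=b_i(\tau_\rho\phi)$. A (global) strong solution of $dX_t=L(X_t)dt+A(X_t)\cdot dB_t$, $X_0=\phi$, is an $\mathcal{S}_{-p}$-valued continuous $\{\mathcal{F}_t\}$-adapted process $X$ such that a.s. for all $t\in[0,T]$, $X_t=\phi+\int_0^tL(X_s)\,ds+\int_0^tA(X_s)\cdot dB_s$ in $\mathcal{S}_{-p-1}$. Standing assumptions: (i) $\bar\sigma,\bar b$ are locally Lipschitz on $\mathbb{R}^d$; (ii) the SDE $Z_t=\int_0^t\bar\sigma(Z_s)\cdot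 dB_s+\int_0^t\bar b(Z_s)\,ds$ in $\mathbb{R}^d$ does not explode and has a unique strong solution on $[0,T]$ (so that $X_t=\tau_{Z_t}\phi$ is a global strong solution of the SPDE above); (iii) there is a constant $\lambda>0$ with $\mathbb{E}\sup_{t\in[0,T]}\|X_t\|_{-p-1}^2\le\lambda$. *)

(* Defs.v *)
From HB Require Import structures.
From mathcomp Require Import all_boot all_order all_algebra.
From mathcomp Require Import all_classical all_reals all_analysis.

Set Implicit Arguments.
Unset Strict Implicit.
Unset Printing Implicit Defensive.

Import Order.TTheory GRing.Theory Num.Theory.
Import numFieldNormedType.Exports.

Local Open Scope classical_set_scope.
Local Open Scope ring_scope.

Definition iter_partial (R : realType) (d : nat) (s : seq 'I_d)
    (f : 'rV[R]_d -> R) : 'rV[R]_d -> R :=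
  foldr (fun (i : 'I_d) (g : 'rV[R]_d -> R) x => 'D_(delta_mx 0 i) g x) f s.

(* Differentiability of all iterated partials is smoothness.  The norm of
   'rV[R]_d is the sup norm, equivalent to the Euclidean one. *)
Definition schwartz (R : realType) (d : nat) (f : 'rV[R]_d -> R) : Prop :=
  forall s : seq 'I_d,
    (forall x, differentiable (iter_partial s f) x) /\
    (forall k : nat, exists C : R, forall x,
       `|x| ^+ k * `|iter_partial s f x| <= C).

(* Distributions are functionals on arbitrary functions 'rV[R]_d -> R, of which
   only the values at Schwartz functions are meaningful; two of them are equal
   as distributions when they satisfy [eq_distr]. *)
Definition sdistribution (R : realType) (d : nat) : Type :=
  ('rV[R]_d -> R) -> R^o.

Definition eq_distr (R : realType) (d : nat) (u v : sdistribution R d) : Prop :=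
  forall f, schwartz f -> u f = v f.

(* The dual of the Schwartz space: linear functionals bounded by a constant
   times finitely many of the seminorms sup_x |x|^k |D^s f(x)|. *)
Definition tempered (R : realType) (d : nat) (u : sdistribution R d) : Prop :=
  (forall (a : R) f g, schwartz f -> schwartz g ->
     u (fun x => a * f x + g x) = a * u f + u g) /\
  (exists (C : R) (N : nat), forall f, schwartz f -> forall M : R,
     (forall (s : seq 'I_d) (k : nat), (size s <= N)%N -> (k <= N)%N ->
        forall x, `|x| ^+ k * `|iter_partial s f x| <= M) ->
     `|u f| <= C * M).

(* Lebesgue integral over R^n as an iterated integral; it is applied only to
   products of two Schwartz functions. *)
Fixpoint integral_Rn (R : realType) (n : nat) : ('rV[R]_n -> R) -> R :=
  match n return ('rV[R]_n -> R) -> R with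
  | 0 => fun f => f 0
  | n'.+1 => fun f => \int[lebesgue_measure]_x
      integral_Rn (fun y : 'rV[R]_n' => f (row_mx (x%:M : 'rV[R]_1) y))
  end.

Definition regular_distr (R : realType) (d : nat) (g : 'rV[R]_d -> R) :
    sdistribution R d :=
  fun f => integral_Rn (fun x => g x * f x).

Definition translate (R : realType) (d : nat) (x : 'rV[R]_d)
    (u : sdistribution R d) : sdistribution R d :=
  fun f => u (fun z => f (z + x)).

Definition dpartial (R : realType) (d : nat) (i : 'I_d)
    (u : sdistribution R d) : sdistribution R d :=
  fun f => - u (fun x => 'D_(delta_mx 0 i) f x).

(* Physicists' Hermite polynomials *)
Definition hermite_poly (R : realType) (k : nat) : {poly R} :=
  iter k (fun H => 2%:R *: ('X * H) - H^`()) 1.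

Definition hermite1 (R : realType) (k : nat) (x : R) : R :=
  (Num.sqrt (2 ^+ k * k`!%:R * Num.sqrt pi))^-1
  * expR (- (x ^+ 2 / 2)) * (hermite_poly R k).[x].

Definition hermite (R : realType) (d : nat) (n : 'I_d -> nat)
    (x : 'rV[R]_d) : R :=
  \prod_(i < d) hermite1 (n i) (x 0 i).

(* The square of the norm of S_q; on [regular_distr f], [f] Schwartz, it is
   sum_n (2|n|+d)^(2q) <f,h_n>^2. *)
Definition hnorm2 (R : realType) (d : nat) (q : R) (u : sdistribution R d) :
    \bar R :=
  \esum_(n in [set: {ffun 'I_d -> nat}])
    (((2 * (\sum_(i < d) n i) + d)%:R `^ (2 * q)
      * (u (hermite (fun i => n i))) ^+ 2)%:E).

Definition hnorm (R : realType) (d : nat) (q : R) (u : sdistribution R d) : R :=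
  Num.sqrt (fine (hnorm2 q u)).

(* The completion of the Schwartz space for the norm of index q, realized
   inside the space of tempered distributions: the closure of the Schwartz
   functions among the tempered distributions of finite norm. *)
Definition sobolev_set (R : realType) (d : nat) (q : R) :
    set (sdistribution R d) :=
  [set u | [/\ tempered u, (hnorm2 q u < +oo)%E
    & exists f : nat -> 'rV[R]_d -> R, (forall k, schwartz (f k)) /\
      hnorm2 q (regular_distr (f k) - u) @[k --> \oo] --> 0%E]].

(* The duality between S_p and S_(-p).  The double series of coefficients is
   absolutely convergent there, so the order of summation is immaterial. *)
Definition duality (R : realType) (d : nat) (u y : sdistribution R d) : R :=
  lim ((\sum_(n : {ffun 'I_d -> 'I_N})
          (u (hermite (fun i => n i)) * y (hermite (fun i => n i))) : R)
       @[N --> \oo]).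

(* A normed space given by a subspace of an ambient module and a norm that is
   meaningful on that subspace. *)
Record nspace (R : realType) (V : lmodType R) := NSpace {
  nset : set V;
  nnorm : V -> R }.

Definition scalars (R : realType) : nspace R^o :=
  NSpace [set: R^o] (fun x => `|x|).

Definition sobolev (R : realType) (d : nat) (q : R) :
    nspace (sdistribution R d) :=
  NSpace (@sobolev_set R d q) (hnorm q).

Definition nopen (R : realType) (V : lmodType R) (S : nspace V) :
    set (set V) :=
  [set U | U `<=` nset S /\ forall v, U v -> exists2 e : R, 0 < e &
     forall w, nset S w -> nnorm S (w - v) < e -> U w].

Definition nborel (R : realType) (V : lmodType R) (S : nspace V) :
    set (set V) := <<s nset S, nopen S >>.

Definition ncontinuous (R : realType) (V : lmodType R) (S : nspace V) (T : R)
    (x : R -> V) : Prop :=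
  forall t : R, t \in `[0, T] ->
    nnorm S (x s - x t) @[s --> within `[0, T] (nbhs t)] --> 0.

(* A sequence of pairs (A, v) stands for the step function sum 1_A v. *)
Definition step_fun (R : realType) (V : lmodType R) (s : seq (set R * V))
    (x : R) : V := \sum_(a <- s) \1_(a.1) x *: a.2.

Definition step_integral (R : realType) (V : lmodType R) (t : R)
    (s : seq (set R * V)) : V :=
  \sum_(a <- s) fine (lebesgue_measure (a.1 `&` `[0, t])) *: a.2.

Definition is_bochner (R : realType) (V : lmodType R) (S : nspace V) (t : R)
    (g : R -> V) (I : V) : Prop :=
  nset S I /\
  exists s : nat -> seq (set R * V),
  [/\ forall n, {in s n, forall a, measurable a.1 /\ nset S a.2},
      \forall x \ae (@lebesgue_measure R), x \in `[0, t] ->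
        nnorm S (step_fun (s n) x - g x) @[n --> \oo] --> 0,
      (\int[lebesgue_measure]_(x in `[0%R, t])
         (nnorm S (step_fun (s n) x - g x))%:E)%E @[n --> \oo] --> 0%E
    & nnorm S (step_integral t (s n) - I) @[n --> \oo] --> 0].

(* The last condition implies that P is complete, as F 0 is made of measurable
   sets. *)
Definition usual_conditions (R : realType) (disp : measure_display)
    (Omega : measurableType disp) (P : probability Omega R) (T : R)
    (F : R -> set (set Omega)) : Prop :=
  [/\ forall t : R, t \in `[0, T] ->
        sigma_algebra [set: Omega] (F t) /\ F t `<=` measurable,
      forall s t : R, 0 <= s -> s <= t -> t <= T -> F s `<=` F t,
      forall t : R, 0 <= t -> t < T -> \bigcap_(s in `]t, T]) F s `<=` F t
    & forall A, P.-negligible A -> F 0 A].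

Definition adapted (R : realType) (Omega : Type) (T : R)
    (F : R -> set (set Omega)) (V : lmodType R) (S : nspace V)
    (X : R -> Omega -> V) : Prop :=
  forall t : R, t \in `[0, T] ->
    (forall w, nset S (X t w)) /\
    (forall A, nborel S A -> F t (X t @^-1` A)).

Definition progressive (R : realType) (Omega : Type) (T : R)
    (F : R -> set (set Omega)) (V : lmodType R) (S : nspace V)
    (X : R -> Omega -> V) : Prop :=
  forall t : R, t \in `[0, T] ->
    (forall w, nset S (X t w)) /\
    (forall A, nborel S A ->
      <<s [set C | exists I G, [/\ measurable (I : set R), F t G
                               & C = I `*` G]] >>
      [set z : R * Omega | z.1 \in `[0, t] /\ A (X z.1 z.2)]).

(* d-dimensional standard Brownian motion relative to the filtration F: the
   increments over [s, t] are N(0, t - s), independent of one another and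
   of F s. *)
Definition brownian_motion (R : realType) (disp : measure_display)
    (Omega : measurableType disp) (mu : {measure set Omega -> \bar R}) (T : R)
    (F : R -> set (set Omega)) (d : nat) (B : 'I_d -> R -> Omega -> R) :
    Prop :=
  [/\ forall j (t : R) (C : set R), t \in `[0, T] -> measurable C ->
        F t (B j t @^-1` C),
      \forall w \ae mu, forall j, B j 0 w = 0,
      \forall w \ae mu, forall j, {within `[0, T], continuous (B j ^~ w)},
      forall j (s t : R) (C : set R), 0 <= s -> s < t -> t <= T -> measurable C ->
        mu [set w | C (B j t w - B j s w)]
        = normal_prob 0 (Num.sqrt (t - s)) C
    & forall (s t : R) (A : set Omega) (C : 'I_d -> set R),
        0 <= s -> s < t -> t <= T -> F s A -> (forall j, measurable (C j)) ->
        mu (A `&` [set w | forall j, C j (B j t w - B j s w)])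
        = (mu A * \prod_(j < d) mu [set w | C j (B j t w - B j s w)%R])%E].

(* The process equal to [svalue k] on ](stime k, stime k.+1]], k < ssteps *)
Record simple_process (R : realType) (Omega : Type) (V : lmodType R) :=
  SimpleProcess {
    ssteps : nat;
    stime : nat -> R;
    svalue : nat -> Omega -> V }.

Definition is_simple (R : realType) (Omega : Type) (T : R)
    (F : R -> set (set Omega)) (V : lmodType R) (S : nspace V)
    (K : simple_process Omega V) : Prop :=
  [/\ 0 <= stime K 0, stime K (ssteps K) <= T,
      forall k, (k < ssteps K)%N -> stime K k <= stime K k.+1
    & forall k, (k < ssteps K)%N ->
        [/\ forall w, nset S (svalue K k w),
            forall A, nborel S A -> F (stime K k) (svalue K k @^-1` A)
          & exists C : R, forall w, nnorm S (svalue K k w) <= C]].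

Definition simple_val (R : realType) (Omega : Type) (V : lmodType R)
    (K : simple_process Omega V) (s : R) (w : Omega) : V :=
  \sum_(k < ssteps K) \1_(`]stime K k, stime K k.+1]%classic) s *: svalue K k w.

Definition simple_integral (R : realType) (Omega : Type) (V : lmodType R)
    (W : R -> Omega -> R) (K : simple_process Omega V) (t : R) (w : Omega) :
    V :=
  \sum_(k < ssteps K)
    (W (Num.min (stime K k.+1) t) w - W (Num.min (stime K k) t) w)
    *: svalue K k w.

(* [is_ito P T F S W H Y]: the process Y is a (continuous) version of the
   S-valued stochastic integral of H against the Brownian motion W on [0, T];
   it is determined by H and W up to indistinguishability. *)
Definition is_ito (R : realType) (disp : measure_display)
    (Omega : measurableType disp) (P : probability Omega R) (T : R)
    (F : R -> set (set Omega)) (V : lmodType R) (S : nspace V)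
    (W : R -> Omega -> R) (H Y : R -> Omega -> V) : Prop :=
  [/\ progressive T F S H,
      \forall w \ae P, (\int[lebesgue_measure]_(s in `[0%R, T])
        ((nnorm S (H s w)) ^+ 2)%:E < +oo)%E,
      adapted T F S Y,
      \forall w \ae P, ncontinuous S T (Y ^~ w)
    & exists K : nat -> simple_process Omega V,
      [/\ forall n, is_simple T F S (K n),
          forall e : R, 0 < e ->
            P [set w | (e%:E <= \int[lebesgue_measure]_(s in `[0%R, T])
              ((nnorm S (simple_val (K n) s w - H s w)) ^+ 2)%:E)%E]
            @[n --> \oo] --> 0%E
        & forall (t e : R), t \in `[0, T] -> 0 < e ->
            P [set w | e <= nnorm S (simple_integral W (K n) t w - Y t w)]
            @[n --> \oo] --> 0%E]].

Definition coeff_mx (R : realType) (d : nat)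
    (sigma : 'I_d -> 'I_d -> sdistribution R d) (y : sdistribution R d) :
    'M[R]_d := \matrix_(i, j) duality (sigma i j) y.

Definition op_L (R : realType) (d : nat)
    (sigma : 'I_d -> 'I_d -> sdistribution R d) (b : 'I_d -> sdistribution R d)
    (y : sdistribution R d) : sdistribution R d :=
  2^-1 *: (\sum_(i < d) \sum_(j < d)
      (coeff_mx sigma y *m (coeff_mx sigma y)^T) i j
      *: dpartial i (dpartial j y))
  - \sum_(i < d) duality (b i) y *: dpartial i y.

Definition op_A (R : realType) (d : nat)
    (sigma : 'I_d -> 'I_d -> sdistribution R d) (j : 'I_d)
    (y : sdistribution R d) : sdistribution R d :=
  - \sum_(i < d) duality (sigma i j) y *: dpartial i y.

Definition spde_solution (R : realType) (disp : measure_display)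
    (Omega : measurableType disp) (P : probability Omega R) (T : R)
    (F : R -> set (set Omega)) (d : nat) (B : 'I_d -> R -> Omega -> R) (p : R)
    (sigma : 'I_d -> 'I_d -> sdistribution R d) (b : 'I_d -> sdistribution R d)
    (phi : sdistribution R d) (X : R -> Omega -> sdistribution R d) : Prop :=
  [/\ adapted T F (sobolev d (- p)) X,
      \forall w \ae P, ncontinuous (sobolev d (- p)) T (X ^~ w)
    & exists (I : R -> Omega -> sdistribution R d)
             (M : 'I_d -> R -> Omega -> sdistribution R d),
      [/\ \forall w \ae P, forall t : R, t \in `[0, T] ->
            is_bochner (sobolev d (- p - 1)) t
              (fun s => op_L sigma b (X s w)) (I t w),
          forall j, is_ito P T F (sobolev d (- p - 1)) (B j)
            (fun s w => op_A sigma j (X s w)) (M j)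
        & \forall w \ae P, forall t : R, t \in `[0, T] ->
            eq_distr (X t w) (phi + I t w + \sum_(j < d) M j t w)]].

Definition sde_solution (R : realType) (disp : measure_display)
    (Omega : measurableType disp) (P : probability Omega R) (T : R)
    (F : R -> set (set Omega)) (d : nat) (B : 'I_d -> R -> Omega -> R)
    (sbar : 'I_d -> 'I_d -> 'rV[R]_d -> R) (bbar : 'I_d -> 'rV[R]_d -> R)
    (Z : R -> Omega -> 'rV[R]_d) : Prop :=
  [/\ forall i, adapted T F (scalars R) (fun t w => Z t w 0 i),
      \forall w \ae P, {within `[0, T], continuous (Z ^~ w)}
    & exists M : 'I_d -> 'I_d -> R -> Omega -> R,
      (forall i j, is_ito P T F (scalars R) (B j)
         (fun s w => sbar i j (Z s w)) (M i j)) /\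
      \forall w \ae P, forall (t : R) i, t \in `[0, T] ->
        Z t w 0 i = \sum_(j < d) M i j t w
          + \int[lebesgue_measure]_(s in `[0, t]) bbar i (Z s w)].

Definition locally_lipschitz (R : realType) (d : nat) (f : 'rV[R]_d -> R) :
    Prop := [locally [lipschitz f x | x in [set: 'rV[R]_d]]].

Definition rms (R : realType) (disp : measure_display)
    (Omega : measurableType disp) (P : probability Omega R) (d : nat) (q : R)
    (X : R -> Omega -> sdistribution R d) (s : R) : R :=
  Num.sqrt (fine 'E_P[fun w => hnorm q (X s w) ^+ 2]).

(* Main.v *)
(* The integrand theta s = sqrt (E |X_s|^2) is deterministic and square
   integrable, so this is the Cameron-Martin case of Girsanov's theorem; the
   equation satisfied by X plays no further role.  For a simple process K the
   theorem is exact: on an interval on which K has a constant value a, known at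
   the left end point, it is the Gaussian identity
     int exp (a x - a^2 t / 2) g (x - a t) dN(0, t) = int g dN(0, t),
   and the statement is transitive in the time interval.  The integral W of
   theta is by definition a limit in probability of integrals of (random)
   simple processes K_n.  Along a subsequence the densities and the shifts
   int K_n ds converge almost surely; as all densities have mean one, the means
   of bounded continuous functions of the increments pass to the limit (Fatou's
   lemma applied to g and to 1 - g), which determines the law of the increments
   under Q jointly with the past. *)
Require Import Defs.
From mathcomp Require Import all_boot all_order all_algebra.
From mathcomp Require Import all_classical all_reals all_analysis.
From mathcomp Require Import measurable_realfun.
From mathcomp Require Import ring lra.

Set Implicit Arguments.
Unset Strict Implicit.
Unset Printing Implicit Defensive.

Import Order.TTheory GRing.Theory Num.Theory.
Import numFieldNormedType.Exports.

Local Open Scope classical_set_scope.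
Local Open Scope ring_scope.

(** * Independence and Gaussian shifts *)

(** Conditional expectations never appear. Conditioning on the past is expressed by an arbitrary
    nonnegative weight measurable for it, and the identities for simple processes are between
    integrals of nonnegative extended-real functions, so that they carry no integrability
    conditions. The delicate point is the passage to the limit. The densities of the simple
    approximations converge only almost surely, with no domination at hand; that the limit density
    also has mean one is what excludes an escape of mass, as in Scheffe's lemma. The shifted
    increments converge only almost surely too, so the test functions must be continuous; open rays
    and then, one coordinate at a time, Borel sets are recovered afterwards. The times [s] and [t]
    of an increment are unrelated to the partitions of the simple processes, and the [d] components
    have different partitions. Both difficulties disappear by proving the identity for all [r <= r']
    at once and splitting at the partition times of all components. *)

Lemma emeasurable_prod (R : realType) (d : measure_display)
    (T : measurableType d) (D : set T) (I : Type) (r : seq I)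
    (f : I -> T -> \bar R) :
  (forall i, measurable_fun D (f i)) ->
  measurable_fun D (fun x => \prod_(i <- r) f i x)%E.
Proof.
move=> mf; elim: r => [|i r ih].
  by under eq_fun do rewrite big_nil; exact: measurable_cst.
by under eq_fun do rewrite big_cons; exact: emeasurable_funM.
Qed.

Section density.
Import HBNNSimple.

(** Both sides commute with increasing limits of nonnegative simple functions, and for the indicator
    of a set the claim is the hypothesis on [nu]. It serves to write Gaussian integrals as Lebesgue
    integrals. *)
Lemma ge0_integral_density (R : realType) (d : measure_display)
    (T : measurableType d) (mu nu : {measure set T -> \bar R})
    (p : T -> R) (f : T -> \bar R) :
  measurable_fun [set: T] p -> (forall x, 0 <= p x) ->
  (forall A, measurable A -> nu A = \int[mu]_(x in A) (p x)%:E)%E ->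
  measurable_fun [set: T] f -> (forall x, 0 <= f x)%E ->
  (\int[nu]_x f x = \int[mu]_x (f x * (p x)%:E))%E.
Proof.
move=> mp p0 nuE mf f0.
pose h := nnsfun_approx measurableT mf.
have hcvg x : (h n x)%:E @[n --> \oo] --> f x.
  by apply: cvg_nnsfun_approx => // ? _; exact: f0.
have hnd x : {homo (fun n => (h n x)%:E) : n m / (n <= m)%N >-> (n <= m)%E}.
  by move=> n m nm; rewrite lee_fin; exact/lefP/nd_nnsfun_approx.
have mpE : measurable_fun [set: T] (fun x => (p x)%:E).
  exact/measurable_EFinP.
have -> : (\int[nu]_x f x = limn (fun n => \int[nu]_x (h n x)%:E))%E.
  under eq_integral => x _ do rewrite -(cvg_lim _ (hcvg x))//.
  apply: monotone_convergence => //.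
  - by move=> n; exact/measurable_EFinP/measurable_funP.
  - by move=> n x _; rewrite lee_fin.
have -> : (\int[mu]_x (f x * (p x)%:E)
    = limn (fun n => \int[mu]_x ((h n x)%:E * (p x)%:E)))%E.
  have hp x : ((h n x)%:E * (p x)%:E)%E @[n --> \oo] --> (f x * (p x)%:E)%E.
    by apply: cvgeZr.
  under eq_integral => x _ do rewrite -(cvg_lim _ (hp x))//.
  apply: monotone_convergence => //.
  - move=> n; apply: emeasurable_funM => //.
    exact/measurable_EFinP/measurable_funP.
  - by move=> n x _; rewrite mule_ge0// lee_fin.
  - by move=> x _ n m nm; rewrite lee_wpmul2r ?lee_fin ?p0// -lee_fin hnd.
congr (limn _); apply/funext => n.
have hE x : (h n x)%:E = (\sum_(k \in range (h n)) (k * \1_(h n @^-1` [set k])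
  x)%:E)%E.
  by rewrite [in LHS]fimfunE -fsumEFin.
under eq_integral do rewrite hE.
rewrite ge0_integral_fsum//; last 2 first.
- by move=> y; exact/measurable_EFinP/measurable_funM.
- by move=> y x _; rewrite nnfun_muleindic_ge0.
have hpE x : ((h n x)%:E * (p x)%:E = \sum_(k \in range (h n)) (k * \1_(h n
  @^-1` [set k]) x * p x)%:E)%E.
  rewrite hE ge0_mule_fsuml//.
  by move=> k; rewrite nnfun_muleindic_ge0.
under [RHS]eq_integral do rewrite hpE.
rewrite ge0_integral_fsum//; last 2 first.
- move=> y; apply/measurable_EFinP/measurable_funM => //.
  exact/measurable_funM.
- move=> y x _; rewrite EFinM mule_ge0//; last by rewrite lee_fin.
  by rewrite nnfun_muleindic_ge0.
apply: eq_fsbigr => k _.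
have mhk : measurable (h n @^-1` [set k]) by exact: measurable_sfunP.
rewrite integralZl_indic_nnsfun// integral_indic// setIT nuE//.
(* A negative level is never attained by [h n], so both sides vanish; the scalar can be pulled out
   of the integral only for [0 <= k]. *)
have [k0|k0] := ltP k 0.
  rewrite preimage_nnfun0// integral_set0 mule0; apply/esym/integral0_eq => x _.
  by rewrite indic0 mulr0 mul0r.
under [RHS]eq_integral do rewrite -mulrA EFinM.
rewrite ge0_integralZl//; last 2 first.
- by apply/measurable_EFinP/measurable_funM => //.
- by move=> x _; rewrite lee_fin mulr_ge0.
congr (_ * _)%E.
rewrite integral_mkcond; apply: eq_integral => x _.
rewrite patchE indicE; case: ifPn => _; by rewrite ?mul1r ?mul0r.
Qed.

End density.

Lemma measure_prodE (R : realType) (d1 d2 : measure_display)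
    (T1 : measurableType d1) (T2 : measurableType d2)
    (m1 m2 : {measure set (T1 * T2) -> \bar R}) :
  (m1 [set: T1 * T2] < +oo)%E ->
  (forall A B, measurable A -> measurable B -> m1 (A `*` B) = m2 (A `*` B)) ->
  forall S, measurable S -> m1 S = m2 S.
Proof.
move=> m1oo m12 S mS.
apply: (measure_unique
  [set A `*` B | A in measurable & B in measurable] (fun=> setT)) => //.
- by rewrite measurable_prod_measurableType.
- move=> _ _ [A1 mA1 [B1 mB1 <-]] [A2 mA2 [B2 mB2 <-]].
  exists (A1 `&` A2); first exact: measurableI.
  by exists (B1 `&` B2); [exact: measurableI|rewrite setXI].
- by move=> _; exists setT => //; exists setT => //; rewrite setXTT.
- by rewrite bigcup_const.
- by move=> _ [A mA [B mB <-]]; exact: m12.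
Qed.

Section independence.
Context (R : realType) (dO : measure_display) (Omega : measurableType dO)
  (P : probability Omega R).

(** By independence the joint law of [X] and [xi] agrees with a product measure on rectangles, hence
    everywhere; Tonelli then integrates [xi] out with [X] frozen. *)
Lemma ge0_integral_indep1 (d1 d2 : measure_display) (E : measurableType d1)
    (S : measurableType d2) (nu : probability S R) (X : Omega -> E)
    (xi : Omega -> S) (f : E * S -> \bar R) :
  measurable_fun setT X -> measurable_fun setT xi ->
  (forall A C, measurable A -> measurable C ->
    P (X @^-1` A `&` xi @^-1` C) = P (X @^-1` A) * nu C)%E ->
  measurable_fun setT f -> (forall z, 0 <= f z)%E ->
  (\int[P]_w f (X w, xi w) = \int[P]_w \int[nu]_x f (X w, x))%E.
Proof.
move=> mX mxi indep mf f0.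
have mXxi : measurable_fun setT (fun w => (X w, xi w)).
  exact: measurable_fun_pair.
pose XX : {RV P >-> (E * S)%type} := mfun_Sub (mem_set mXxi).
pose PXxi : probability (E * S)%type R := distribution P XX.
pose X' : {RV P >-> E} := mfun_Sub (mem_set mX).
pose PX' : probability E R := distribution P X'.
have lawE C : measurable C -> (PX' \x nu)%E C = PXxi C.
  apply: product_measure_unique => A B mA mB; exact: indep.
rewrite -[LHS](@ge0_integral_distribution _ _ _ _ _ P XX f mf f0).
rewrite (eq_measure_integral (PX' \x nu)%E); last first.
  by move=> C mC _; apply/esym/lawE.
rewrite fubini_tonelli1//= /fubini_F.
rewrite ge0_integral_distribution//.
- exact: measurable_fun_fubini_tonelli_F.
- by move=> y; apply: integral_ge0.
Qed.

(** Induction on [n]: the pair of [X] and the variable of index 0 becomes the new past, of which the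
    other variables are independent. All [f j] may depend on [X], which is what random integrands
    require later. *)
Lemma ge0_integral_indep (d1 d2 : measure_display) (E : measurableType d1)
    (S : measurableType d2) (nu : probability S R) (n : nat) (X : Omega -> E)
    (xi : 'I_n -> Omega -> S) (Y : E -> \bar R) (f : 'I_n -> E * S -> \bar R) :
  measurable_fun setT X -> (forall j, measurable_fun setT (xi j)) ->
  (forall (A : set E) (C : 'I_n -> set S),
    measurable A -> (forall j, measurable (C j)) ->
    P (X @^-1` A `&` [set w | forall j, C j (xi j w)])
    = P (X @^-1` A) * \prod_(j < n) nu (C j))%E ->
  measurable_fun setT Y -> (forall z, 0 <= Y z)%E ->
  (forall j, measurable_fun setT (f j)) -> (forall j z, 0 <= f j z)%E ->
  (\int[P]_w (Y (X w) * \prod_(j < n) f j (X w, xi j w))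
   = \int[P]_w (Y (X w) * \prod_(j < n) \int[nu]_x f j (X w, x)))%E.
Proof.
elim: n d1 E X xi Y f => [|n IH] d1 E X xi Y f mX mxi indep mY Y0 mf f0.
  by apply: eq_integral => w _; rewrite !big_ord0.
pose consC (B : set S) (C : 'I_n -> set S) (j : 'I_n.+1) :=
  if unlift ord0 j is Some i then C i else B.
have consC0 B C : consC B C ord0 = B by rewrite /consC unlift_none.
have consCS B C i : consC B C (lift ord0 i) = C i by rewrite /consC liftK.
have mconsC B C : measurable B -> (forall j, measurable (C j)) ->
    forall j, measurable (consC B C j).
  by move=> mB mC j; rewrite /consC; case: unliftP.
have indep0 A B C : measurable A -> measurable B ->
    (forall j, measurable (C j)) ->
    (P ((X @^-1` A `&` xi ord0 @^-1` B)
       `&` [set w | forall j, C j (xi (lift ord0 j) w)])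
     = P (X @^-1` A) * nu B * \prod_(j < n) nu (C j))%E.
  move=> mA mB mC.
  have := indep A (consC B C) mA (mconsC _ _ mB mC).
  rewrite big_ord_recl consC0; under eq_bigr do rewrite consCS.
  rewrite muleA => <-; congr (P _); rewrite -setIA; congr (_ `&` _).
  apply/seteqP; split=> w /=.
    by move=> [wB wC] j; rewrite /consC; case: unliftP => [i ->|->].
  move=> wC; split; first by have := wC ord0; rewrite consC0.
  by move=> j; have := wC (lift ord0 j); rewrite consCS.
have indep1 A B : measurable A -> measurable B ->
    (P (X @^-1` A `&` xi ord0 @^-1` B) = P (X @^-1` A) * nu B)%E.
  move=> mA mB; have := indep0 A B (fun=> setT) mA mB (fun=> measurableT).
  rewrite (_ : [set w | _] = setT); last by apply/seteqP; split.
  rewrite setIT => ->; rewrite big1 ?mule1// => j _.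
  exact: probability_setT.
pose X' w := (X w, xi ord0 w).
have mX' : measurable_fun setT X' by exact: measurable_fun_pair.
have indep' (M : set (E * S)%type) (C : 'I_n -> set S) :
    measurable M -> (forall j, measurable (C j)) ->
    (P (X' @^-1` M `&` [set w | forall j, C j (xi (lift ord0 j) w)])
     = P (X' @^-1` M) * \prod_(j < n) nu (C j))%E.
  move=> mM mC; set D := [set w | _].
  have mD : measurable D.
    rewrite (_ : D = \bigcap_(j in [set: 'I_n]) (xi (lift ord0 j) @^-1` C j)).
      apply: fin_bigcap_measurable => // j _.
      by rewrite -[_ @^-1` _]setTI; apply: mxi.
    by apply/seteqP; split=> w /= wD j; [move=> _; exact: wD|exact: wD].
  set c := (\prod_(j < n) nu (C j))%E.
  have c0 : (0 <= c)%E by exact: prode_ge0.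
  have cfin : c \is a fin_num.
    rewrite /c; elim/big_ind: _ => // [x y|j _]; first exact: fin_numM.
    exact: fin_num_measure.
  have fc0 : 0 <= fine c by exact: fine_ge0.
  (* For fixed [C], both sides of the independence of [X'] are finite measures in [M]. The
     hypothesis gives their equality on rectangles, and [measure_prodE] extends it to all measurable
     sets of the product. The scale factor [c] is finite, as [mscale] takes a nonnegative real. *)
  pose m1 : {measure set (E * S)%type -> \bar R} :=
    pushforward (mrestr P mD) X'.
  pose m2 : {measure set (E * S)%type -> \bar R} :=
    mscale (NngNum fc0) (pushforward P X').
  have m12 : m1 mX' M = m2 mX' M.
    apply: measure_prodE => //.
      rewrite /m1 /= /pushforward /mrestr preimage_setT setTI.
      by apply: le_lt_trans (probability_le1 _ mD) _; rewrite ltry.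
    move=> A B mA mB; rewrite /m1 /m2 /= /pushforward /mrestr /mscale /=.
    have -> : X' @^-1` (A `*` B) = X @^-1` A `&` xi ord0 @^-1` B by [].
    rewrite fineK// indep0// [RHS]muleC; congr (_ * _)%E.
    exact/esym/indep1.
  by move: m12; rewrite /m1 /m2 /= /pushforward /mrestr /mscale /= fineK//
    muleC.
under eq_integral do rewrite big_ord_recl muleA.
pose Y' (z : E * S) := (Y z.1 * f ord0 z)%E.
pose f' (j : 'I_n) (z : (E * S) * S) := f (lift ord0 j) (z.1.1, z.2).
transitivity (\int[P]_w (Y' (X' w) * \prod_(j < n) f' j (X' w,
  xi (lift ord0 j) w)))%E.
  by [].
rewrite (IH _ (E * S)%type)//; last 4 first.
- apply: emeasurable_funM => //; exact: measurableT_comp.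
- by move=> z; rewrite mule_ge0.
- move=> j; apply: measurableT_comp => //.
  by apply: measurable_fun_pair => //; exact: measurableT_comp.
- by move=> j z; exact: f0.
rewrite /Y' /f' /X' /=.
pose N i (e : E) := (\int[nu]_x f i (e, x))%E.
have mN i : measurable_fun setT (N i) by exact: measurable_fun_fubini_tonelli_F.
have N0 i e : (0 <= N i e)%E by apply: integral_ge0.
(* The factors already integrated depend on [X] alone, so the integrand involves only [X] and
   [xi ord0], and the case of one variable finishes. *)
pose h (z : E * S) := (Y z.1 * f ord0 z * \prod_(j < n) N (lift ord0 j) z.1)%E.
transitivity (\int[P]_w h (X w, xi ord0 w))%E; first by [].
rewrite (ge0_integral_indep1 (nu := nu))//; last 2 first.
- apply: emeasurable_funM.
    by apply: emeasurable_funM => //; exact: measurableT_comp.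
  apply: emeasurable_prod => j.
  exact: measurableT_comp.
- by move=> z; rewrite mule_ge0 ?mule_ge0 ?prode_ge0.
apply: eq_integral => w _; rewrite /h /= big_ord_recl.
under eq_integral do rewrite muleAC.
have mfX : measurable_fun setT (fun x => f ord0 (X w, x)).
  by apply: measurableT_comp => //; exact: measurable_fun_pair.
rewrite ge0_integralZl//; last by rewrite mule_ge0// prode_ge0.
by rewrite -muleA [X in (_ * X)%E]muleC.
Qed.

End independence.

Lemma lebesgue_measureB (R : realType) (c : R) (A : set (measurableTypeR R)) :
  measurable A ->
  pushforward lebesgue_measure
    ((fun x => x - c) : measurableTypeR R -> measurableTypeR R) A
  = lebesgue_measure A.
Proof.
move=> mA.
apply/esym; apply: lebesgue_measure_unique => //=.
  exact: measurable_funB.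
move=> _ _ [[a b]] _ <-.
rewrite /pushforward.
rewrite (_ : _ @^-1` _ = `](a + c), (b + c)]%classic); last first.
  apply/seteqP; split=> x /=; rewrite !in_itv/=; lra.
rewrite !lebesgue_measure_itv/= !lte_fin ltrD2r.
by case: ifPn => // _; rewrite -!EFinB; congr (_%:E); lra.
Qed.

Lemma ge0_integral_translate (R : realType) (c : R) (h : R -> \bar R) :
  measurable_fun setT h -> (forall x, 0 <= h x)%E ->
  (\int[lebesgue_measure]_x h (x - c)%R = \int[lebesgue_measure]_x h x)%E.
Proof.
move=> mh h0.
have ms : measurable_fun setT
    ((fun x => x - c) : measurableTypeR R -> measurableTypeR R).
  exact: measurable_funB.
transitivity (\int[pushforward lebesgue_measure
    ((fun x => (x - c)%R) : measurableTypeR R -> measurableTypeR R)]_x h x)%E.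
  by rewrite ge0_integral_pushforward.
by apply: eq_measure_integral => A mA _; exact: lebesgue_measureB.
Qed.

(** Completing the square: the exponential times the density of N(0, dt) at x is that density at
    [x - a * dt]. Translating Lebesgue measure by [a * dt] then removes the shift. Positivity of
    [dt] ensures that the Gaussian law has a density. The offset [v] is the place of a value frozen
    by the past. *)
Lemma normal_prob_shift (R : realType) (a v dt : R) (g : R -> \bar R) :
  0 < dt -> measurable_fun setT g -> (forall x, 0 <= g x)%E ->
  (\int[normal_prob 0 (Num.sqrt dt)]_x
      ((expR (a * x - 2^-1 * (a ^+ 2 * dt))%R)%:E * g (v + (x - a * dt))%R)
   = \int[normal_prob 0 (Num.sqrt dt)]_x g (v + x)%R)%E.
Proof.
move=> dt0 mg g0.
set s := Num.sqrt dt.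
have s2 : s ^+ 2 = dt by rewrite sqr_sqrtr// ltW.
have s0 : s != 0 by rewrite gt_eqF// sqrtr_gt0.
have mgv : measurable_fun setT (fun x => g (v + x)).
  by apply: (measurableT_comp mg); exact: measurable_funD.
have mpdf := @measurable_normal_pdf R 0 s.
rewrite (@ge0_integral_density _ _ _ lebesgue_measure (normal_prob 0 s)
  (normal_pdf 0 s))//; last 3 first.
- by move=> x; exact: normal_pdf_ge0.
- apply: emeasurable_funM.
    by apply/measurable_EFinP/measurableT_comp => //;
      apply: measurable_funB => //; exact: measurable_funM.
  apply: (measurableT_comp mgv); exact: measurable_funB.
- by move=> x; rewrite mule_ge0// lee_fin expR_ge0.
rewrite [RHS](@ge0_integral_density _ _ _ lebesgue_measure (normal_prob 0 s)
  (normal_pdf 0 s))//; last first.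
  by move=> x; exact: normal_pdf_ge0.
rewrite -[RHS](ge0_integral_translate (a * dt)); last 2 first.
- by apply: emeasurable_funM => //; exact/measurable_EFinP.
- by move=> x; rewrite mule_ge0// lee_fin normal_pdf_ge0.
apply: eq_integral => x _ /=.
rewrite muleC muleA -EFinM muleC; congr (_ * _%:E)%E.
rewrite !normal_pdfE// /normal_fun -mulrA; congr (_ * _).
rewrite -expRD; congr expR; rewrite s2 !subr0 -mulr_natr.
by field; rewrite gt_eqF.
Qed.

(** * Girsanov's theorem for simple processes *)

(** A filtration consists of bare sets of sets. Passing to [g_sigma_algebraType] makes [F t] the
    sigma-algebra of a measurable type, so that the closure properties of measurable functions and
    the product theory apply to it. *)
Definition meas_in (T : pointedType) (G : set (set T)) (d : measure_display)
    (U : measurableType d) (f : T -> U) : Prop :=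
  measurable_fun [set: g_sigma_algebraType G] (f : g_sigma_algebraType G -> U).

Lemma meas_inS (T : pointedType) (G H : set (set T)) (d : measure_display)
    (U : measurableType d) (f : T -> U) :
  G `<=` H -> meas_in G f -> meas_in H f.
Proof.
move=> GH mf _ C mC; apply: (sub_sigma_algebra2 GH).
exact: (mf measurableT).
Qed.

Section filtration.
Context (R : realType) (disp : measure_display) (Omega : measurableType disp)
  (P : probability Omega R) (T : R) (F : R -> set (set Omega))
  (F_usual : usual_conditions P T F).

Lemma filtration_measurable t : 0 <= t -> t <= T -> F t `<=` measurable.
Proof.
by move=> t0 tT; case: F_usual => /(_ t); rewrite in_itv/= t0 tT => /(_ isT)[].
Qed.

Lemma filtration_sigma t : 0 <= t -> t <= T -> sigma_algebra setT (F t).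
Proof.
by move=> t0 tT; case: F_usual => /(_ t); rewrite in_itv/= t0 tT => /(_ isT)[].
Qed.

Lemma filtration_mono s t : 0 <= s -> s <= t -> t <= T -> F s `<=` F t.
Proof. by case: F_usual => _ /(_ s t). Qed.

Lemma meas_in_measurable t (d : measure_display) (U : measurableType d)
    (f : Omega -> U) :
  0 <= t -> t <= T -> meas_in (F t) f -> measurable_fun setT f.
Proof.
move=> t0 tT mf _ C mC; have := mf measurableT C mC.
by rewrite measurable_g_measurableTypeE;
  [exact: filtration_measurable|exact: filtration_sigma].
Qed.

Lemma meas_in_mono s t (d : measure_display) (U : measurableType d)
    (f : Omega -> U) :
  0 <= s -> s <= t -> t <= T -> meas_in (F s) f -> meas_in (F t) f.
Proof. by move=> s0 st tT; apply: meas_inS; exact: filtration_mono. Qed.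

Lemma meas_inP t (d : measure_display) (U : measurableType d)
    (f : Omega -> U) :
  0 <= t -> t <= T ->
  meas_in (F t) f <-> (forall C, measurable C -> F t (f @^-1` C)).
Proof.
move=> t0 tT; rewrite /meas_in; split=> [mf C mC|mf _ C mC].
  have := mf measurableT C mC.
  by rewrite measurable_g_measurableTypeE ?setTI//; exact: filtration_sigma.
rewrite measurable_g_measurableTypeE ?setTI; first exact: mf.
exact: filtration_sigma.
Qed.

Context (d : nat) (B : 'I_d -> R -> Omega -> R)
  (B_brownian : brownian_motion P T F B).

Lemma brownian_meas_in j t : 0 <= t -> t <= T -> meas_in (F t) (B j t).
Proof.
move=> t0 tT; apply/meas_inP => // C mC; case: B_brownian => + _ _ _ _.
by apply => //; rewrite in_itv/= t0.
Qed.

Lemma brownian_meas_in_le j s t :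
  0 <= s -> s <= t -> t <= T -> meas_in (F t) (B j s).
Proof.
move=> s0 st tT; apply: (meas_in_mono s0 st tT).
by apply: brownian_meas_in => //; exact: le_trans tT.
Qed.

(** [ge0_integral_indep] with [X] the identity from [Omega] to [Omega] equipped with [F s]: the
    whole past is frozen in the first argument of [f j], and the increments are integrated out
    against their Gaussian laws. *)
Lemma ge0_integral_increments s t (Y : Omega -> \bar R)
    (f : 'I_d -> g_sigma_algebraType (F s) * R -> \bar R) :
  0 <= s -> s < t -> t <= T ->
  meas_in (F s) Y -> (forall w, 0 <= Y w)%E ->
  (forall j, measurable_fun setT (f j)) -> (forall j z, 0 <= f j z)%E ->
  (\int[P]_w (Y w * \prod_(j < d) f j (w, (B j t w - B j s w)%R))
   = \int[P]_w (Y w * \prod_(j < d)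
       \int[normal_prob 0 (Num.sqrt (t - s))]_x f j (w, x)))%E.
Proof.
move=> s0 st tT mY Y0 mf f0.
have sT : s <= T by rewrite ltW// (lt_le_trans st).
have t0 : 0 <= t by rewrite (le_trans s0)// ltW.
have mB j : measurable_fun setT (fun w => B j t w - B j s w).
  apply: measurable_funB; apply: meas_in_measurable (brownian_meas_in j _ _) =>
    //.
have := @ge0_integral_indep R disp Omega P _ _ (g_sigma_algebraType (F s))
  (measurableTypeR R) (normal_prob 0 (Num.sqrt (t - s))) d id
  (fun j w => B j t w - B j s w) Y f.
apply => //.
  by apply: meas_in_measurable s0 sT _; exact: measurable_id.
move=> A C; rewrite measurable_g_measurableTypeE; last exact: filtration_sigma.
move=> FA mC; case: B_brownian => _ _ _ gauss indep.
rewrite [LHS]indep//; congr (_ * _)%E; apply: eq_bigr => j _.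
exact: (gauss j s t (C j) s0 st tT (mC j)).
Qed.

End filtration.

Section girsanov.
Context (R : realType) (disp : measure_display) (Omega : measurableType disp)
  (P : probability Omega R) (T : R) (F : R -> set (set Omega))
  (F_usual : usual_conditions P T F)
  (d : nat) (B : 'I_d -> R -> Omega -> R)
  (B_brownian : brownian_motion P T F B)
  (I J L : 'I_d -> R -> Omega -> R).

(** [I], [J] and [L] stand for the integrals of K dB, K ds and K^2 ds; they stay abstract because
    only their increments matter. This is the factor of the exponential martingale that belongs to
    the interval from [r] to [r']. *)
Definition density_incr (r r' : R) (j : 'I_d) (w : Omega) : R :=
  expR (I j r' w - I j r w - 2^-1 * (L j r' w - L j r w)).

Definition shifted_incr (r r' : R) (j : 'I_d) (w : Omega) : R :=
  (B j r' w - J j r' w) - (B j r w - J j r w).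

(* The variables [V] and the weight [Y], known at time r, make this property
   of time intervals transitive. *)
Definition girsanov_on (r r' : R) : Prop :=
  [/\ forall j, meas_in (F r') (density_incr r r' j),
      forall j, meas_in (F r') (shifted_incr r r' j)
    & forall (Y : Omega -> \bar R) (V : 'I_d -> Omega -> R)
        (g : 'I_d -> R -> \bar R),
        meas_in (F r) Y -> (forall w, 0 <= Y w)%E ->
        (forall j, meas_in (F r) (V j)) ->
        (forall j, measurable_fun setT (g j)) -> (forall j x, 0 <= g j x)%E ->
        (\int[P]_w (Y w * \prod_(j < d)
            ((density_incr r r' j w)%:E
             * g j (V j w + shifted_incr r r' j w)%R))
         = \int[P]_w (Y w * \prod_(j < d)
            g j (V j w + (B j r' w - B j r w))%R))%E].

Lemma girsanov_on_refl r : girsanov_on r r.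
Proof.
have Z1 j w : density_incr r r j w = 1.
  by rewrite /density_incr !subrr mulr0 subr0 expR0.
have S0 j w : shifted_incr r r j w = 0 by rewrite /shifted_incr subrr.
split.
- by move=> j; rewrite (_ : density_incr _ _ _ = cst 1);
    [exact: measurable_cst|apply/funext => w].
- by move=> j; rewrite (_ : shifted_incr _ _ _ = cst 0);
    [exact: measurable_cst|apply/funext => w].
- move=> Y V g _ _ _ _ _; apply: eq_integral => w _.
  by congr (_ * _)%E; apply: eq_bigr => j _; rewrite Z1 S0 subrr mul1e.
Qed.

(** With the past frozen, [a j w] and [V j w] are constants. Integrating out the increments turns
    both sides into products of Gaussian integrals, which agree factor by factor by
    [normal_prob_shift]. *)
Lemma girsanov_on_elementary r r' (a : 'I_d -> Omega -> R) :
  0 <= r -> r < r' -> r' <= T ->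
  (forall j, meas_in (F r) (a j)) ->
  (forall j w, I j r' w - I j r w = a j w * (B j r' w - B j r w)) ->
  (forall j w, J j r' w - J j r w = a j w * (r' - r)) ->
  (forall j w, L j r' w - L j r w = a j w ^+ 2 * (r' - r)) ->
  girsanov_on r r'.
Proof.
move=> r0 rr' r'T ma aI aJ aL.
have r'0 : 0 <= r' by rewrite (le_trans r0)// ltW.
have ma' j : meas_in (F r') (a j).
  by apply: (meas_in_mono F_usual r0 (ltW rr')).
have mB j : meas_in (F r') (fun w => B j r' w - B j r w).
  apply: measurable_funB; first exact: (brownian_meas_in F_usual B_brownian).
  exact: (brownian_meas_in_le F_usual B_brownian j r0 (ltW rr')).
have ZE j w : density_incr r r' j w
    = expR (a j w * (B j r' w - B j r w) - 2^-1 * (a j w ^+ 2 * (r' - r))).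
  by rewrite /density_incr aI aL.
have SE j w : shifted_incr r r' j w = B j r' w - B j r w - a j w * (r' - r).
  by rewrite /shifted_incr -aJ; ring.
split.
- move=> j; rewrite (funext (ZE j)).
  apply: (measurableT_comp (@measurable_expR R)); apply: measurable_funB.
    by apply: measurable_funM; [exact: ma'|exact: mB].
  apply: measurable_funM => //; apply: measurable_funM => //.
  by apply: measurable_funX; exact: ma'.
- move=> j; rewrite (funext (SE j)); apply: measurable_funB; first exact: mB.
  by apply: measurable_funM => //; exact: ma'.
move=> Y V g mY Y0 mV mg g0.
pose E := g_sigma_algebraType (F r).
have m1 (f : E -> R) : measurable_fun setT f ->
    measurable_fun setT (fun z : E * R => f z.1).
  by move=> mf; exact: measurableT_comp.
pose f j (z : E * R) :=
  ((expR (a j z.1 * z.2 - 2^-1 * (a j z.1 ^+ 2 * (r' - r)))%R)%:E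
   * g j (V j z.1 + (z.2 - a j z.1 * (r' - r)))%R)%E.
have mf j : measurable_fun setT (f j).
  have ma2 : measurable_fun setT (fun z : E * R => a j z.1 * z.2).
    by apply: measurable_funM => //; apply: m1; exact: ma.
  apply: emeasurable_funM.
    apply/measurable_EFinP/measurableT_comp => //; apply: measurable_funB => //.
    apply: measurable_funM => //; apply: measurable_funM => //.
    by apply: measurable_funX; apply: m1; exact: ma.
  apply: (measurableT_comp (mg j)); apply: measurable_funD.
    by apply: m1; exact: mV.
  apply: measurable_funB => //; apply: measurable_funM => //.
  by apply: m1; exact: ma.
pose h j (z : E * R) := g j (V j z.1 + z.2).
have mh j : measurable_fun setT (h j).
  by apply: (measurableT_comp (mg j)); apply: measurable_funD => //; apply: m1;
    exact: mV.
transitivity (\int[P]_w (Y w * \prod_(j < d) f j (w,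
  (B j r' w - B j r w)%R)))%E.
  apply: eq_integral => w _; congr (_ * _)%E; apply: eq_bigr => j _.
  by rewrite ZE SE.
transitivity (\int[P]_w (Y w * \prod_(j < d) h j (w,
  (B j r' w - B j r w)%R)))%E; last by [].
have h0 j z : (0 <= h j z)%E by exact: g0.
have f0 j z : (0 <= f j z)%E by rewrite mule_ge0// lee_fin expR_ge0.
have fE := ge0_integral_increments F_usual B_brownian r0 rr' r'T mY Y0 mf f0.
have hE := ge0_integral_increments F_usual B_brownian r0 rr' r'T mY Y0 mh h0.
apply: (etrans fE); apply: etrans (esym hE).
apply: eq_integral => w _; congr (_ * _)%E; apply: eq_bigr => j _.
by rewrite /f /h /= normal_prob_shift// subr_gt0.
Qed.

(** The density up to [r'] joins the weight and the shifted increment up to [r'] joins the offset,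
    so the later interval can be treated first. Its Brownian increment is then averaged out, which
    leaves new test functions for the earlier interval. *)
Lemma girsanov_on_trans r r' r'' : 0 <= r -> r < r' -> r' < r'' -> r'' <= T ->
  girsanov_on r r' -> girsanov_on r' r'' -> girsanov_on r r''.
Proof.
move=> r0 rr' r'r'' r''T [mZ1 mS1 G1] [mZ2 mS2 G2].
have r'0 : 0 <= r' by rewrite (le_trans r0)// ltW.
have r'T : r' <= T by rewrite (le_trans _ r''T)// ltW.
have ZE j w : density_incr r r'' j w = density_incr r r' j w * density_incr r'
  r'' j w.
  by rewrite /density_incr -expRD; congr expR; ring.
have SE j w : shifted_incr r r'' j w = shifted_incr r r' j w + shifted_incr r'
  r'' j w.
  by rewrite /shifted_incr; ring.
have up (e : measure_display) (U : measurableType e) (f : Omega -> U) :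
    meas_in (F r') f -> meas_in (F r'') f.
  by apply: (meas_in_mono F_usual r'0 (ltW r'r'')).
have up0 (e : measure_display) (U : measurableType e) (f : Omega -> U) :
    meas_in (F r) f -> meas_in (F r') f.
  by apply: (meas_in_mono F_usual r0 (ltW rr')).
split.
- move=> j; rewrite (funext (ZE j)); apply: measurable_funM; last exact: mZ2.
  exact: (up _ _ _ (mZ1 j)).
- move=> j; rewrite (funext (SE j)); apply: measurable_funD; last exact: mS2.
  exact: (up _ _ _ (mS1 j)).
move=> Y V g mY Y0 mV mg g0.
pose Z w := (\prod_(j < d) (density_incr r r' j w)%:E)%E.
have Z0 w : (0 <= Z w)%E by apply: prode_ge0 => j; rewrite lee_fin expR_ge0.
pose Y' w := (Y w * Z w)%E.
have mY' : meas_in (F r') Y'.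
  apply: emeasurable_funM; first exact: (up0 _ _ _ mY).
  by apply: emeasurable_prod => j; apply/measurable_EFinP; exact: mZ1.
have Y'0 w : (0 <= Y' w)%E by rewrite mule_ge0.
pose V' j w := V j w + shifted_incr r r' j w.
have mV' j : meas_in (F r') (V' j).
  by apply: measurable_funD; [exact: (up0 _ _ _ (mV j))|exact: mS1].
pose V2 j w := V j w + (B j r' w - B j r w).
have mV2 j : meas_in (F r') (V2 j).
  apply: measurable_funD; first exact: (up0 _ _ _ (mV j)).
  apply: measurable_funB; first exact: (brownian_meas_in F_usual B_brownian).
  exact: (brownian_meas_in_le F_usual B_brownian j r0 (ltW rr')).
pose N := normal_prob 0 (Num.sqrt (r'' - r')).
(* One step of the Gaussian semigroup from [r''] back to [r']; [g'] is the test function to which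
   the earlier interval is applied. *)
pose g' j v := (\int[N]_x g j (v + x)%R)%E.
have mgD j : measurable_fun setT (fun z : R * R => g j (z.1 + z.2)).
  by apply: (measurableT_comp (mg j)); exact: measurable_funD.
have mg' j : measurable_fun setT (g' j).
  exact: (@measurable_fun_fubini_tonelli_F _ _ _ _ _ N _ (mgD j)).
have g'0 j v : (0 <= g' j v)%E by apply: integral_ge0.
have avg (Y1 : Omega -> \bar R) (U : 'I_d -> Omega -> R) :
    meas_in (F r') Y1 -> (forall w, 0 <= Y1 w)%E ->
    (forall j, meas_in (F r') (U j)) ->
    (\int[P]_w (Y1 w * \prod_(j < d) g j (U j w + (B j r'' w - B j r' w))%R)
     = \int[P]_w (Y1 w * \prod_(j < d) g' j (U j w)))%E.
  move=> mY1 Y10 mU.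
  pose f j (z : g_sigma_algebraType (F r') * R) := g j (U j z.1 + z.2).
  apply: (@ge0_integral_increments _ _ _ _ _ _ F_usual _ _ B_brownian _ _ _ f)
    => //; last by move=> j z; exact: g0.
  move=> j; apply: (measurableT_comp (mg j)); apply: measurable_funD => //.
  by apply: (measurableT_comp (mU j)).
transitivity (\int[P]_w (Y' w * \prod_(j < d)
    ((density_incr r' r'' j w)%:E * g j (V' j w + shifted_incr r' r'' j
      w)%R)))%E.
  apply: eq_integral => w _; rewrite /Y' /Z -muleA -big_split/=.
  congr (_ * _)%E; apply: eq_bigr => j _.
  by rewrite ZE SE EFinM -muleA addrA.
rewrite G2// avg//.
transitivity (\int[P]_w (Y w * \prod_(j < d)
    ((density_incr r r' j w)%:E * g' j (V j w + shifted_incr r r' j w)%R)))%E.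
  by apply: eq_integral => w _; rewrite /Y' /Z -muleA -big_split.
(* [avg] is now read backwards, with the unshifted offset [V2], to restore the increment from [r']
   to [r'']. *)
rewrite G1// -(avg _ V2)//; last exact: (up0 _ _ _ mY).
apply: eq_integral => w _; congr (_ * _)%E; apply: eq_bigr => j _.
by congr (g j _); rewrite /V2; ring.
Qed.

End girsanov.

(** Open intervals generate the Borel sets and are open in the sense of [nopen]. This connects the
    adaptedness conditions, stated with [nborel], to ordinary measurability on [R]. *)
Lemma nborel_scalars (R : realType) (C : set R) :
  measurable C -> nborel (scalars R) C.
Proof.
move=> mC; have : (@RGenOpens.G R).-sigma.-measurable C.
  by rewrite -RGenOpens.measurableE.
apply: sub_sigma_algebra2 => U [a [b ->]]; split => //= x.
rewrite in_itv/= => /andP[ax xb]; exists (Num.min (x - a) (b - x)).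
  by rewrite lt_min !subr_gt0 ax xb.
move=> y _ /=; rewrite lt_min => /andP[]; rewrite !ltr_norml in_itv/=; lra.
Qed.

(** * Simple processes between consecutive partition times *)

Section simple_process.
Context (R : realType) (Omega : Type) (K : simple_process Omega R^o).
Local Notation val := (simple_val K).

Lemma measurable_simple_val w : measurable_fun setT (val ^~ w : R -> R).
Proof.
by apply: measurable_sum => k; apply: measurable_funM => //;
  exact: measurable_indic.
Qed.

Lemma simple_val_bounded w : exists M, forall s, `|(val s w : R)| <= M.
Proof.
exists (\sum_(k < ssteps K) `|(svalue K k w : R)|) => s.
apply: le_trans (ler_norm_sum _ _ _) _; apply: ler_sum => k _.
rewrite normrM ler_piMl// ger0_norm ?indicE ?ler0n// lern1.
exact: leq_b1.
Qed.

Lemma integrable_simple_val n (t : R) w :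
  lebesgue_measure.-integrable `[0, t]
    (EFin \o (fun s => (val s w : R) ^+ n)).
Proof.
apply: measurable_bounded_integrable => //.
- by rewrite /= lebesgue_measure_itv/=; case: ifPn => // _; rewrite -EFinB ltry.
- by apply: measurable_funTS; apply: measurable_funX;
    exact: measurable_simple_val.
- have [M valM] := simple_val_bounded w.
  exists (M ^+ n); split; first by rewrite num_real.
  move=> x Mx s _; apply: (le_trans _ (ltW Mx)).
  by rewrite normrX; apply: lerXn2r; rewrite ?nnegrE// (le_trans _ (valM 0)).
Qed.

Section elementary_interval.
Context (r r' : R) (rr' : r < r')
  (no_time : forall k, (k <= ssteps K)%N ->
     stime K k <= r \/ r' <= stime K k)
  (mono_time : forall k, (k < ssteps K)%N -> stime K k <= stime K k.+1).

(** The pieces of a simple process are open on the left and closed on the right, so none of them can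
    begin or end inside []r, r']]. The right end point therefore represents the constant value. *)
Lemma simple_val_elementary s w : r < s -> s <= r' -> val s w = val r' w.
Proof.
move=> rs sr'; apply: eq_bigr => k _; congr (_ *: _).
rewrite !indicE; congr (_%:R); congr nat_of_bool.
apply/idP/idP; rewrite !inE /= !in_itv/= => /andP[tk tk1]; apply/andP;
  have [] := no_time (ltnW (ltn_ord k)); have [] := no_time (ltn_ord k);
  split; lra.
Qed.

Lemma simple_integral_elementary (W : R -> Omega -> R) w :
  (simple_integral W K r' w : R) - simple_integral W K r w
  = (val r' w : R) * (W r' w - W r w).
Proof.
rewrite /simple_integral -sumrB /simple_val mulr_suml; apply: eq_bigr => k _.
rewrite -scalerBl [LHS]mulrC [in RHS]/GRing.scale/=.
rewrite [\1_ _ _ * _]mulrC -mulrA; congr (_ * _).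
have tt := mono_time (ltn_ord k).
rewrite indicE.
have no0 : stime K k <= r \/ r' <= stime K k by exact:
  no_time (ltnW (ltn_ord k)).
have no1 : stime K k.+1 <= r \/ r' <= stime K k.+1 by exact:
  no_time (ltn_ord k).
(* Four positions of the piece [k]: to the left of [r], covering []r, r']], impossible since its end
   would precede its beginning, to the right of [r']. Only the covering piece contributes to the
   increment. *)
have [t0|t0] := no0; have [t1|t1] := no1.
- have m0 := le_trans t0 (ltW rr'); have m1 := le_trans t1 (ltW rr').
  rewrite memNset/=; last first.
    by rewrite in_itv/= [r' <= _]leNgt (le_lt_trans t1 rr') andbF.
  by rewrite !min_l// mul0r; ring.
- have m0 := le_trans t0 (ltW rr'); have m1 := le_trans (ltW rr') t1.
  rewrite mem_set/=; last by rewrite in_itv/= t1 (le_lt_trans t0 rr').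
  by rewrite (min_r t1) (min_r m1) (min_l t0) (min_l m0) mul1r; ring.
- have := le_lt_trans (le_trans (le_trans t0 tt) t1) rr'.
  by rewrite ltxx.
- have m0 := le_trans (ltW rr') t0; have m1 := le_trans (ltW rr') t1.
  rewrite memNset/=; last by rewrite in_itv/= ltNge t0.
  by rewrite !min_r// mul0r; ring.
Qed.

(** The difference is an integral over []r, r']], where the integrand is constant. The exponent 1
    serves for [simple_J], the exponent 2 for [simple_L]. *)
Lemma integral_simple_val_elementary n w : 0 <= r ->
  \int[lebesgue_measure]_(s in `[0, r']) (val s w : R) ^+ n
  - \int[lebesgue_measure]_(s in `[0, r]) (val s w : R) ^+ n
  = (val r' w : R) ^+ n * (r' - r).
Proof.
move=> r0; rewrite Rintegral_itvB//; last 2 first.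
- exact: (integrable_simple_val n r' w).
- by rewrite bnd_simp ltW.
rewrite (@eq_Rintegral _ _ _ _ _ (cst ((val r' w : R) ^+ n))); last first.
  move=> s; rewrite inE/= in_itv/= => /andP[rs sr'].
  by rewrite (simple_val_elementary w rs sr').
by rewrite Rintegral_cst//= lebesgue_measure_itv/= lte_fin rr' -EFinB.
Qed.

End elementary_interval.

End simple_process.

Section partition_times.
Context (R : realType) (Omega : Type) (T : R) (F : R -> set (set Omega))
  (V : lmodType R) (S : nspace V) (K : simple_process Omega V)
  (K_simple : is_simple T F S K).

Lemma stime_mono k : (k < ssteps K)%N -> stime K k <= stime K k.+1.
Proof. by case: K_simple => _ _ + _; apply. Qed.

Lemma stime_itv k : (k <= ssteps K)%N -> 0 <= stime K k <= T.
Proof.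
move=> kn; have [K0 KT _ _] := K_simple; apply/andP; split.
  elim: k kn => // k IH kn; apply: le_trans (IH (ltnW kn)) _.
  exact: stime_mono.
(* The bound by [T] is known at the last time and descends from there: induction on the number of
   steps between [k] and [ssteps K]. *)
move: kn KT (stime_mono); move: (ssteps K) => n kn; rewrite -(subnKC kn).
elim: (n - k)%N => [|m IH]; first by rewrite addn0.
rewrite addnS => KT Kmono; apply: IH => [|i im].
  by apply: le_trans KT; apply: Kmono.
by apply: Kmono; rewrite ltnS ltnW.
Qed.

End partition_times.

Section simple_girsanov.
Context (R : realType) (disp : measure_display) (Omega : measurableType disp)
  (P : probability Omega R) (T : R) (F : R -> set (set Omega))
  (F_usual : usual_conditions P T F)
  (d : nat) (B : 'I_d -> R -> Omega -> R)
  (B_brownian : brownian_motion P T F B)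
  (K : 'I_d -> simple_process Omega R^o)
  (K_simple : forall j, is_simple T F (scalars R) (K j)).

Definition simple_I (j : 'I_d) (t : R) (w : Omega) : R :=
  simple_integral (B j) (K j) t w.
Definition simple_J (j : 'I_d) (t : R) (w : Omega) : R :=
  \int[lebesgue_measure]_(s in `[0, t]) (simple_val (K j) s w : R).
Definition simple_L (j : 'I_d) (t : R) (w : Omega) : R :=
  \int[lebesgue_measure]_(s in `[0, t]) (simple_val (K j) s w : R) ^+ 2.

Local Notation Gir := (girsanov_on P F B simple_I simple_J simple_L).

(** A piece active at [r'] begins before [r'], hence by [no_time] not after [r]; its value is thus
    already known at time [r]. This is the predictability that [girsanov_on_elementary] requires. *)
Lemma simple_val_meas_in j r r' : 0 <= r -> r < r' -> r' <= T ->
  (forall k, (k <= ssteps (K j))%N ->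
    stime (K j) k <= r \/ r' <= stime (K j) k) ->
  meas_in (F r) (simple_val (K j) r' : Omega -> R).
Proof.
move=> r0 rr' r'T no_time.
have rT : r <= T by rewrite ltW// (lt_le_trans rr').
apply: measurable_sum => k.
have kn := ltn_ord k; have /andP[tk0 tkT] := stime_itv (K_simple j) (ltnW kn).
have [_ _ _ /(_ _ kn)[_ sm _]] := K_simple j.
rewrite indicE; case: (boolP (r' \in _)) => [|_]; last first.
  by under eq_fun do rewrite scale0r; exact: measurable_cst.
rewrite inE/= in_itv/= => /andP[tkr' _].
have tkr : stime (K j) k <= r.
  by case: (no_time _ (ltnW kn)) => // /(lt_le_trans tkr'); rewrite ltxx.
under eq_fun do rewrite scale1r.
apply: (meas_in_mono F_usual tk0 tkr rT).
apply/(meas_inP F_usual) => // C mC; apply: sm; exact: nborel_scalars.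
Qed.

Lemma simple_girsanov_on r r' : 0 <= r -> r <= r' -> r' <= T -> Gir r r'.
Proof.
move=> r0; rewrite le_eqVlt => /predU1P[<- _|]; first exact: girsanov_on_refl.
(* The times of all [d] processes together, the last one [stime (K j) (ssteps (K j))] included, so
   that one refinement serves every component. *)
pose ts := flatten [seq [seq stime (K j) k | k <- iota 0 (ssteps (K j)).+1]
                   | j <- enum 'I_d].
have : forall j k, (k <= ssteps (K j))%N ->
    r < stime (K j) k -> stime (K j) k < r' -> stime (K j) k \in ts.
  move=> j k kn _ _; apply/flattenP => /=.
  exists [seq stime (K j) k | k <- iota 0 (ssteps (K j)).+1].
    by apply/mapP; exists j => //; rewrite mem_enum.
  by apply/mapP; exists k => //; rewrite mem_iota.
elim: ts r r0 r' => [|x ts IH] r r0 r' tsP rr' r'T.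
  have no_time j k : (k <= ssteps (K j))%N ->
      stime (K j) k <= r \/ r' <= stime (K j) k.
    move=> kn; have [tr|rt] := leP (stime (K j) k) r; first by left.
    have [r't|tr'] := leP r' (stime (K j) k); first by right.
    by have := tsP _ _ kn rt tr'; rewrite in_nil.
  apply: (@girsanov_on_elementary _ _ _ _ _ _ F_usual _ _ B_brownian _ _ _ r r'
    (fun j => simple_val (K j) r')) => //.
  - by move=> j; apply: simple_val_meas_in => // k; exact: no_time.
  - move=> j w; apply: simple_integral_elementary => //.
      exact: no_time.
    exact: (stime_mono (K_simple j)).
  - move=> j w; have := integral_simple_val_elementary rr' (@no_time j) 1 w r0.
    by rewrite !expr1.
  - move=> j w; exact: (integral_simple_val_elementary rr' (@no_time j) 2 w r0).
have [/andP[rx xr']|xout] := boolP (r < x < r').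
  apply: (girsanov_on_trans F_usual B_brownian r0 rx xr' r'T).
    apply: IH => //; last by rewrite ltW// (lt_le_trans xr').
    move=> j k kn rt tx; have := tsP j k kn rt (lt_trans tx xr').
    (* After splitting at [x], this time is an end point of both halves and so is strictly inside
       neither; it can leave the list. *)
    by rewrite inE => /predU1P[tE|//]; rewrite tE ltxx in tx.
  apply: IH => //; first by rewrite (le_trans r0)// ltW.
  move=> j k kn xt tr'; have := tsP j k kn (lt_trans rx xt) tr'.
  by rewrite inE => /predU1P[tE|//]; rewrite tE ltxx in xt.
apply: IH => // j k kn rt tr'; have := tsP j k kn rt tr'.
by rewrite inE => /predU1P[tE|//]; rewrite -tE rt tr' in xout.
Qed.

Local Notation Zinc := (density_incr simple_I simple_L).
Local Notation Sinc := (shifted_incr B simple_J).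

(** The density factors over the intervals from 0 to [s], [s] to [t] and [t] to [T]. The first
    factor and the indicator of [A] form a weight known at time [s], the second turns the shifted
    increments into Brownian ones, and the third integrates out. *)
Lemma simple_girsanov s t (A : set Omega) :
  0 <= s -> s < t -> t <= T -> F s A ->
  forall (g : 'I_d -> R -> \bar R),
  (forall j, measurable_fun setT (g j)) -> (forall j x, 0 <= g j x)%E ->
  (\int[P]_w ((\1_A w)%:E * \prod_(j < d) (Zinc 0 T j w)%:E
      * \prod_(j < d) g j (Sinc s t j w))
   = (\int[P]_w ((\1_A w)%:E * \prod_(j < d) (Zinc 0 T j w)%:E))
     * \prod_(j < d) \int[normal_prob 0 (Num.sqrt (t - s))]_x g j x)%E.
Proof.
move=> s0 st tT FA.
have sT : s <= T by rewrite ltW// (lt_le_trans st).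
have t0 : 0 <= t by rewrite (le_trans s0)// ltW.
have [mZ1 _ _] := simple_girsanov_on (lexx 0) s0 sT.
have [mZ2 mS2 G2] := simple_girsanov_on s0 (ltW st) tT.
have [mZ3 _ G3] := simple_girsanov_on t0 tT (lexx T).
have up (e : measure_display) (U : measurableType e) (f : Omega -> U) :
    meas_in (F s) f -> meas_in (F t) f.
  exact: (meas_in_mono F_usual s0 (ltW st) tT).
pose Y1 w := ((\1_A w)%:E * \prod_(j < d) (Zinc 0 s j w)%:E)%E.
have Z0 a b w : (0 <= \prod_(j < d) (Zinc a b j w)%:E)%E.
  by apply: prode_ge0 => j; rewrite lee_fin expR_ge0.
have Y10 w : (0 <= Y1 w)%E by rewrite mule_ge0// lee_fin.
have mY1 : meas_in (F s) Y1.
  apply: emeasurable_funM.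
    apply/measurable_EFinP; apply: measurable_indic.
    rewrite measurable_g_measurableTypeE//; exact: (filtration_sigma F_usual).
  by apply: emeasurable_prod => j; apply/measurable_EFinP; exact: mZ1.
have shuffle (x1 x2 x3 x4 x5 : \bar R) :
    (x1 * (x2 * x3 * x4) * x5 = x1 * x2 * (x3 * x5) * x4)%E.
  by rewrite !muleA [LHS]muleAC.
have ZE w : (\prod_(j < d) (Zinc 0 T j w)%:E = \prod_(j < d) (Zinc 0 s j w)%:E *
    \prod_(j < d) (Zinc s t j w)%:E * \prod_(j < d) (Zinc t T j w)%:E)%E.
  rewrite -!big_split; apply: eq_bigr => j _.
  by rewrite /= -!EFinM /density_incr -!expRD; congr (expR _)%:E; ring.
have key (g : 'I_d -> R -> \bar R) :
    (forall j, measurable_fun setT (g j)) -> (forall j x, 0 <= g j x)%E ->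
  (\int[P]_w ((\1_A w)%:E * \prod_(j < d) (Zinc 0 T j w)%:E
      * \prod_(j < d) g j (Sinc s t j w))
   = (\int[P]_w (Y1 w))
     * \prod_(j < d) \int[normal_prob 0 (Num.sqrt (t - s))]_x g j x)%E.
  move=> mg g0.
  pose Y2 w := (Y1 w * \prod_(j < d) ((Zinc s t j w)%:E * g j (0 + Sinc s t j
    w)%R))%E.
  have Y20 w : (0 <= Y2 w)%E.
    by rewrite mule_ge0// prode_ge0// => j; rewrite mule_ge0// lee_fin expR_ge0.
  have mY2 : meas_in (F t) Y2.
    apply: emeasurable_funM; first exact: (up _ _ _ mY1).
    apply: emeasurable_prod => j; apply: emeasurable_funM.
      by apply/measurable_EFinP; exact: mZ2.
    apply: (measurableT_comp (mg j)); apply: measurable_funD => //; exact: mS2.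
  have m0 r (j : 'I_d) : meas_in (F r) (cst 0 : Omega -> R) by exact:
    measurable_cst.
  transitivity (\int[P]_w (Y2 w * \prod_(j < d)
      ((Zinc t T j w)%:E * cst 1%E (cst 0 w + Sinc t T j w)%R)))%E.
    apply: eq_integral => w _; rewrite ZE; apply: (etrans (shuffle _ _ _ _ _)).
    rewrite /Y2 big_split; congr (_ * _ * _)%E; last first.
      by apply: eq_bigr => j _; rewrite mule1.
    by congr (_ * _)%E; apply: eq_bigr => j _; rewrite add0r.
  (* With test functions equal to 1, the Girsanov identity after [t] only removes the last density
     factor. *)
  rewrite (G3 Y2 (fun=> cst 0) (fun=> cst 1%E))//.
  under eq_integral do rewrite big1// mule1.
  rewrite /Y2 (G2 Y1 (fun=> cst 0) g)//.
  under eq_integral do under eq_bigr do rewrite add0r.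
  pose f j (z : g_sigma_algebraType (F s) * R) := g j z.2.
  have mf j : measurable_fun setT (f j) by exact: measurableT_comp.
  have f0 j z : (0 <= f j z)%E by exact: g0.
  pose N := normal_prob 0 (Num.sqrt (t - s)).
  have N0 j : (0 <= \int[N]_x g j x)%E by apply: integral_ge0.
  rewrite (ge0_integral_increments F_usual B_brownian s0 st tT mY1 Y10 mf f0)
    /f /=.
  rewrite ge0_integralZr//; first exact: (meas_in_measurable F_usual s0 sT mY1).
  - by apply: prode_ge0 => j _; exact: N0.
  - exact: m0.
  - exact: m0.
have one : (\prod_(j < d) \int[normal_prob 0 (Num.sqrt (t - s))]_x
    (cst 1%E : R -> \bar R) x = 1)%E.
  rewrite big1// => j _; rewrite integral_cst// mul1e.
  exact: (@probability_setT _ _ _ (normal_prob 0 (Num.sqrt (t - s)))).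
(* [key] with all test functions equal to 1: on events of [F s] the density up to [T] and the
   density up to [s] have the same integral. *)
have Y1E : (\int[P]_w ((\1_A w)%:E * \prod_(j < d) (Zinc 0 T j w)%:E)
    = \int[P]_w Y1 w)%E.
  rewrite -[RHS]mule1 -[X in _ = (_ * X)%E]one.
  rewrite -(key (fun=> cst 1%E) (fun=> measurable_cst _) (fun _ _ => lee01)).
  by apply: eq_integral => w _; rewrite [X in _ = (_ * X)%E]big1// mule1.
by move=> g mg g0; rewrite Y1E; exact: key.
Qed.

Lemma simple_density_mean1 : 0 <= T ->
  (\int[P]_w \prod_(j < d) (Zinc 0 T j w)%:E = 1)%E.
Proof.
move=> T0; have [_ _ G] := simple_girsanov_on (lexx 0) T0 (lexx T).
have := G (cst 1%E) (fun=> cst 0) (fun=> cst 1%E).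
under eq_integral do rewrite mul1e.
under eq_integral do under eq_bigr do rewrite mule1.
move=> ->//.
- under eq_integral do rewrite mul1e big1//.
  rewrite integral_cst// mul1e; exact: probability_setT.
- exact: measurable_cst.
- by move=> j; exact: measurable_cst.
Qed.

End simple_girsanov.

(** * Limits of weighted means *)

Section weighted_means.
Context (R : realType) (dO : measure_display) (Omega : measurableType dO)
  (P : {measure set Omega -> \bar R}).

(** Fatou's lemma in the form needed for epsilon arguments. The lower limit is the supremum of the
    infima over tails, so one of these infima already exceeds [y]. *)
Lemma fatou_lt (f : nat -> Omega -> \bar R) (g : Omega -> \bar R) (y : \bar R) :
  (forall n, measurable_fun setT (f n)) -> measurable_fun setT g ->
  (forall n w, 0 <= f n w)%E ->
  (\forall w \ae P, f n w @[n --> \oo] --> g w) ->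
  (y < \int[P]_w g w)%E ->
  exists N, forall n, (N <= n)%N -> (y < \int[P]_w f n w)%E.
Proof.
move=> mf mg f0 fg.
have -> : (\int[P]_w g w = \int[P]_w limn_einf (f ^~ w))%E.
  apply: ae_eq_integral => //.
    apply: (measurableT_comp (@oppe_measurable R setT));
      apply: measurable_fun_limn_esup => n.
    exact: (measurableT_comp (@oppe_measurable R setT)).
  apply: filterS fg => w fgw _.
  by have [-> _] := cvg_limn_einf_sup fgw.
move=> yg; have : (y < limn_einf (fun n => \int[P]_w f n w))%E.
  by apply: lt_le_trans yg _; apply: fatou => // n w _.
rewrite limn_einf_lim; set a := fun n => _.
have /cvg_lim -> // := ereal_nondecreasing_cvgn (@nondecreasing_einfs _ a).
move=> /ereal_sup_gt[_ [N _ <-] yN]; exists N => n Nn.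
apply: lt_le_trans yN _; apply: ereal_inf_lbound.
by exists n.
Qed.

(** The equality of total masses replaces domination: the means of [G] and of [1 - G] add up to 1
    along the sequence and in the limit, so a lower bound for the second is an upper bound for the
    first. Both the weights and the bounded functions may vary with [n]. *)
Lemma cvg_weighted_mean (D_ : nat -> Omega -> R) (D : Omega -> R)
    (G_ : nat -> Omega -> R) (G : Omega -> R) :
  (forall n, measurable_fun setT (D_ n)) -> measurable_fun setT D ->
  (forall n, measurable_fun setT (G_ n)) -> measurable_fun setT G ->
  (forall n w, 0 <= D_ n w) -> (forall w, 0 <= D w) ->
  (forall n w, 0 <= G_ n w <= 1) -> (forall w, 0 <= G w <= 1) ->
  (forall n, \int[P]_w (D_ n w)%:E = 1)%E -> (\int[P]_w (D w)%:E = 1)%E ->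
  (\forall w \ae P, D_ n w @[n --> \oo] --> D w) ->
  (\forall w \ae P, G_ n w @[n --> \oo] --> G w) ->
  (\int[P]_w (G_ n w * D_ n w)%:E @[n --> \oo] --> \int[P]_w (G w * D w)%:E)%E.
Proof.
move=> mD_ mD mG_ mG D_0 D0 G_01 G01 D_1 D1 DD GG.
have split1 (g h : Omega -> R) : measurable_fun setT g ->
  measurable_fun setT h ->
    (forall w, 0 <= h w) -> (forall w, 0 <= g w <= 1) ->
    (\int[P]_w (h w)%:E = 1)%E ->
    (\int[P]_w (g w * h w)%:E + \int[P]_w ((1 - g w) * h w)%:E = 1)%E.
  move=> mg mh h0 g01 <-.
  rewrite -ge0_integralD//.
  - by apply: eq_integral => w _; rewrite -EFinD; congr (_%:E); ring.
  - by move=> w _; rewrite lee_fin mulr_ge0//; have /andP[] := g01 w.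
  - by apply/measurable_EFinP/measurable_funM.
  - by move=> w _; rewrite lee_fin mulr_ge0// subr_ge0; have /andP[] := g01 w.
  - by apply/measurable_EFinP/measurable_funM => //; exact: measurable_funB.
have ge0 (g h : Omega -> R) : (forall w, 0 <= h w) -> (forall w, 0 <= g w) ->
    (0 <= \int[P]_w (g w * h w)%:E)%E.
  by move=> h0 g0; apply: integral_ge0 => w _; rewrite lee_fin mulr_ge0.
have real1 (a b : \bar R) : (0 <= a)%E -> (0 <= b)%E -> (a + b = 1)%E ->
    exists r : R, a = r%:E /\ b = (1 - r)%:E.
  case: a b => [a| |] [b| |]//= _ _ [ab]; exists a; split => //.
  by congr (_%:E); rewrite -ab; ring.
have GE n : exists r : R, (\int[P]_w (G_ n w * D_ n w)%:E = r%:E /\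
    \int[P]_w ((1 - G_ n w) * D_ n w)%:E = (1 - r)%:E)%E.
  apply: real1; last exact: split1.
    by apply: ge0 => // w; have /andP[] := G_01 n w.
  by apply: ge0 => // w; rewrite subr_ge0; have /andP[] := G_01 n w.
have [l [lE l1E]] : exists r : R, (\int[P]_w (G w * D w)%:E = r%:E /\
    \int[P]_w ((1 - G w) * D w)%:E = (1 - r)%:E)%E.
  apply: real1; last exact: split1.
    by apply: ge0 => // w; have /andP[] := G01 w.
  by apply: ge0 => // w; rewrite subr_ge0; have /andP[] := G01 w.
have [u uE] := choice GE.
rewrite lE (_ : (fun n => _) = (EFin \o u)); last first.
  by apply/funext => n /=; have [] := uE n.
apply/cvg_EFin; first exact: nearW.
rewrite (_ : fine \o (EFin \o u) = u)//.
apply/cvgrPdist_lt => e e0.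
have [N1 N1P] : exists N, forall n, (N <= n)%N ->
    ((l - e)%:E < \int[P]_w (G_ n w * D_ n w)%:E)%E.
  apply: (@fatou_lt (fun n w => (G_ n w * D_ n w)%:E) (fun w =>
    (G w * D w)%:E)).
  - by move=> n; apply/measurable_EFinP/measurable_funM.
  - by apply/measurable_EFinP/measurable_funM.
  - by move=> n w; rewrite lee_fin mulr_ge0//; have /andP[] := G_01 n w.
  - apply: filterS2 DD GG => w Dw Gw; apply/cvg_EFin; first exact: nearW.
    exact: cvgM.
  - by rewrite lE lte_fin; lra.
have [N2 N2P] : exists N, forall n, (N <= n)%N ->
    ((1 - l - e)%:E < \int[P]_w ((1 - G_ n w) * D_ n w)%:E)%E.
  apply: (@fatou_lt (fun n w => ((1 - G_ n w) * D_ n w)%:E)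
    (fun w => ((1 - G w) * D w)%:E)).
  - by move=> n; apply/measurable_EFinP/measurable_funM => //;
      exact: measurable_funB.
  - by apply/measurable_EFinP/measurable_funM => //; exact: measurable_funB.
  - by move=> n w; rewrite lee_fin mulr_ge0// subr_ge0;
      have /andP[] := G_01 n w.
  - apply: filterS2 DD GG => w Dw Gw; apply/cvg_EFin; first exact: nearW.
    by apply: cvgM => //; apply: cvgB => //; exact: cvg_cst.
  - by rewrite l1E lte_fin; lra.
exists (maxn N1 N2) => // n /=; rewrite geq_max => /andP[n1 n2].
have [E1 E2] := uE n.
(* The two bounds read [l - e < u n] and [1 - l - e < 1 - u n]. *)
have := N1P n n1; have := N2P n n2; rewrite E1 E2 !lte_fin ltr_norml => h1 h2.
apply/andP; split; lra.
Qed.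

End weighted_means.

(** * From continuous test functions to rays and Borel sets *)

Lemma measure_of_rays (R : realType)
    (m1 m2 : {measure set (measurableTypeR R) -> \bar R}) :
  (m1 setT < +oo)%E -> (forall c : R, m1 `]-oo, c[%classic = m2 `]-oo,
    c[%classic) ->
  forall X : set (measurableTypeR R), measurable X -> m1 X = m2 X.
Proof.
move=> m1oo m12 X mX.
apply: (@measure_unique _ R (measurableTypeR R) (@RGenInftyO.G R)
  (fun n => `]-oo, n%:R[%classic) _ _ _ _ m1 m2) => //.
- exact: RGenInftyO.measurableE.
- move=> _ _ [a ->] [b ->]; exists (Num.min a b); apply/seteqP; split=> x /=;
    by rewrite !in_itv/= lt_min => /andP.
- by move=> n; exists n%:R.
- apply/seteqP; split=> // x _; exists (Num.trunc `|x|).+1 => //=.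
  rewrite in_itv/=; apply: le_lt_trans (ler_norm x) _.
  by have /andP[] := Num.Theory.trunc_itv (normr_ge0 x).
- by move=> _ [a ->].
- move=> n; apply: le_lt_trans m1oo; apply: le_measure; rewrite ?inE//.
Qed.

(** Coordinates are freed one at a time. In [H k] the sets of index below [k] are arbitrary Borel
    sets and the others are rays; with all other sets fixed, both sides are finite measures of the
    set of index [k], and these agree on rays. *)
Lemma measure_indep_of_rays (R : realType) (dO : measure_display)
    (Omega : measurableType dO) (mu : {measure set Omega -> \bar R})
    (nu : probability (measurableTypeR R) R) (d : nat)
    (eta : 'I_d -> Omega -> R) :
  (mu setT < +oo)%E -> (forall j, measurable_fun setT (eta j)) ->
  (forall c : 'I_d -> R, mu [set w | forall j, (eta j w < c j)%R]
    = mu setT * \prod_(j < d) nu `]-oo, c j[%classic)%E ->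
  forall C : 'I_d -> set R, (forall j, measurable (C j)) ->
    (mu [set w | forall j, C j (eta j w)] = mu setT * \prod_(j < d) nu (C j))%E.
Proof.
move=> muoo meta rays.
have mset (p : pred 'I_d) (C : 'I_d -> set R) : (forall j, measurable (C j)) ->
    measurable [set w | forall j, p j -> C j (eta j w)].
  move=> mC; rewrite (_ : [set w | _] = \bigcap_(j in [set j | p j]) (eta j
    @^-1` C j)).
    apply: fin_bigcap_measurable => // j _.
    by rewrite -[_ @^-1` _]setTI; apply: meta.
  by apply/seteqP; split=> w /= wD j; exact: wD.
suff H k : forall C : 'I_d -> set R, (forall j, measurable (C j)) ->
    (forall j : 'I_d, (k <= j)%N -> exists c, C j = `]-oo, c[%classic) ->
    (mu [set w | forall j, C j (eta j w)] = mu setT * \prod_(j < d) nu (C j))%E.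
  move=> C mC; apply: (H d) => // j; by rewrite leqNgt ltn_ord.
elim: k => [|k IH] C mC Crays.
  have [c cE] := choice (fun j => Crays j (leq0n j)).
  under eq_bigr do rewrite cE.
  rewrite -rays; congr (mu _); apply/seteqP; split=> w /= wC j.
    by have := wC j; rewrite cE /= in_itv.
  by rewrite cE /= in_itv; exact: wC.
(* Beyond the last coordinate there is nothing to free, and the condition on rays is vacuous. *)
have [dk|kd] := leqP d k.
  apply: IH => // j kj; have := leq_ltn_trans kj (ltn_ord j).
  by rewrite ltnNge dk.
pose i := Ordinal kd.
pose upd (X : set R) j := if j == i then X else C j.
have updC : upd (C i) = C.
  by apply/funext => j; rewrite /upd; case: eqP => [->|].
have mupd X j : measurable X -> measurable (upd X j).
  by move=> mX; rewrite /upd; case: ifP.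
pose E := [set w | forall j, j != i -> C j (eta j w)].
have mE : measurable E by exact: mset.
pose c := (mu setT * \prod_(j < d | j != i) nu (C j))%E.
have c0 : (0 <= c)%E.
  by rewrite mule_ge0//; apply: prode_ge0 => j _.
have cfin : c \is a fin_num.
  apply: fin_numM; first by rewrite ge0_fin_numE.
  elim/big_ind: _ => // [x y|j _]; first exact: fin_numM.
  exact: (fin_num_measure nu _ (mC j)).
have fc0 : 0 <= fine c by exact: fine_ge0.
pose eta_i : Omega -> measurableTypeR R := eta i.
have metai : measurable_fun setT eta_i by exact: meta.
(* The two sides as measures of the set of index [i]: the law of [eta i] restricted to the
   constraints [E] on the other coordinates, and [nu] scaled by the finite constant [c]. *)
pose m1 : {measure set (measurableTypeR R) -> \bar R} :=
  pushforward (mrestr mu mE) eta_i.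
pose m2 : {measure set (measurableTypeR R) -> \bar R} := mscale (NngNum fc0) nu.
have m1E X : m1 metai X = mu [set w | forall j, upd X j (eta j w)].
  rewrite /m1 /= /pushforward /mrestr; congr (mu _).
  apply/seteqP; split=> w /=.
    move=> [wX wE] j; rewrite /upd; case: eqP => [->//|/eqP ji]; exact: wE.
  move=> wX; split; first by have := wX i; rewrite /upd eqxx.
  by move=> j /negPf ji; have := wX j; rewrite /upd ji.
have m2E X : (m2 X = mu setT * \prod_(j < d) nu (upd X j))%E.
  rewrite /m2 /= /mscale /= fineK// (bigD1 i)//= {1}/upd eqxx.
  rewrite [in RHS](eq_bigr (fun j => nu (C j))); last first.
    by move=> j /negPf ji; rewrite /upd ji.
  by rewrite /c muleCA muleC.
rewrite -[in LHS]updC -[in RHS]updC -m1E -m2E.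
apply: measure_of_rays; last exact: mC.
  rewrite /m1 /= /pushforward /mrestr (le_lt_trans _ muoo)//.
  apply: le_measure; rewrite ?inE// preimage_setT setTI//.
move=> x; rewrite m1E m2E; apply: IH => [j|j kj]; first exact: mupd.
rewrite /upd; case: eqP => [_|/eqP ji]; first by exists x.
apply: Crays; rewrite ltn_neqAle kj andbT; apply: contra ji => /eqP kj'.
by apply/eqP/val_inj.
Qed.

Lemma prod_EFin (R : realType) (I : Type) (r : seq I) (f : I -> R) :
  (\prod_(i <- r) (f i)%:E = (\prod_(i <- r) f i)%R%:E)%E.
Proof. by rewrite (big_morph EFin (@EFinM R) erefl). Qed.

Lemma cvg_prodr (R : realType) (I : Type) (r : seq I) (f : nat -> I -> R)
    (l : I -> R) :
  (forall i, f n i @[n --> \oo] --> l i) ->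
  \prod_(i <- r) f n i @[n --> \oo] --> \prod_(i <- r) l i.
Proof.
move=> fl; elim: r => [|i r IH].
  by under eq_fun do rewrite big_nil; rewrite big_nil; exact: cvg_cst.
under eq_fun do rewrite big_cons; rewrite big_cons; exact: cvgM.
Qed.

Lemma prodr_01 (R : realType) (I : Type) (r : seq I) (f : I -> R) :
  (forall i, 0 <= f i <= 1) -> 0 <= \prod_(i <- r) f i <= 1.
Proof.
move=> f01; elim: r => [|i r /andP[p0 p1]]; first by rewrite big_nil ler01 lexx.
have /andP[f0 f1] := f01 i.
by rewrite big_cons mulr_ge0// mulr_ile1.
Qed.

Section rays.
Context (R : realType).

(** A continuous approximation from below of the indicator of the open ray []-oo, c[]: for positive
    [n] it is 1 up to [c - 1/n], 0 from [c] on and affine in between. For [n = 0] it is identically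
    0. *)
Definition ramp (c : R) (n : nat) (x : R) : R :=
  Num.max 0 (Num.min 1 (n%:R * (c - x))).

Lemma ramp01 c n x : 0 <= ramp c n x <= 1.
Proof.
rewrite /ramp le_max lexx/= ge_max ler01/= ge_min lexx//.
Qed.

Lemma continuous_ramp c n : continuous (ramp c n).
Proof.
move=> x.
have lin : {for x, continuous ((fun y => n%:R * (c - y)) : R -> R^o)}.
  by apply: cvgM; [exact: cvg_cst|apply: cvgB; [exact: cvg_cst|exact: cvg_id]].
have one : {for x, continuous (cst 1 : R -> R^o)} by exact: cvg_cst.
have zero : {for x, continuous (cst 0 : R -> R^o)} by exact: cvg_cst.
exact: (continuous_max zero (continuous_min one lin)).
Qed.

Lemma cvg_ramp c x :
  ramp c n x @[n --> \oo] --> (\1_(`]-oo, c[%classic : set R) x : R).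
Proof.
have [xc|cx] := ltP x c; last first.
  rewrite indicE memNset/=; last by rewrite in_itv/= ltNge cx.
  rewrite (_ : (fun n => _) = cst 0); first exact: cvg_cst.
  apply/funext => n; rewrite /ramp max_l// ge_min mulr_ge0_le0 ?orbT//.
  by rewrite subr_le0.
rewrite indicE mem_set/=; last by rewrite in_itv.
have cx0 : 0 < c - x by rewrite subr_gt0.
apply/cvgrPdist_lt => e e0.
exists (Num.trunc ((c - x)^-1)).+1 => // n /= nN.
have cn : (c - x)^-1 <= n%:R.
  have inv0 : 0 <= (c - x)^-1 by rewrite invr_ge0 ltW.
  have /andP[_ /ltW h] := Num.Theory.trunc_itv inv0.
  by apply: le_trans h _; rewrite ler_nat.
rewrite (_ : ramp c n x = 1) ?subrr ?normr0//.
by rewrite /ramp min_l ?max_r// -ler_pdivrMr// div1r.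
Qed.

Lemma cvg_prob_ramp (nu : probability (measurableTypeR R) R) c :
  (\int[nu]_x (ramp c n x)%:E @[n --> \oo] --> nu `]-oo, c[%classic)%E.
Proof.
have mr n : measurable_fun setT (ramp c n : measurableTypeR R -> R).
  by apply: continuous_measurable_fun; exact: continuous_ramp.
have mi : measurable_fun setT (\1_(`]-oo, c[%classic) : measurableTypeR R -> R).
  by apply: measurable_indic; exact: measurable_itv.
have one : (\int[nu]_x (cst 1%R x)%:E = 1)%E.
  transitivity (\int[nu]_x (cst 1%E : _ -> \bar R) x)%E; first by [].
  by rewrite integral_cst// mul1e; exact: probability_setT.
have -> : (nu `]-oo, c[%classic
    = \int[nu]_x (\1_(`]-oo, c[%classic : set R) x * cst 1%R x)%R%:E)%E.
  under eq_integral do rewrite mulr1.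
  by rewrite integral_indic//= setIT.
(* Inserting the constant weight 1 lets [cvg_weighted_mean] act as bounded convergence. *)
rewrite (_ : (fun n => _) = (fun n => \int[nu]_x (ramp c n x * cst 1 x)%:E)%E).
  apply: (@cvg_weighted_mean R _ (measurableTypeR R) nu (fun=> cst 1)) => //.
  - by move=> n x; exact: ramp01.
  - by move=> x; rewrite indicE; case: (x \in _); rewrite ?lexx ?ler01.
  - by apply: nearW => x; exact: cvg_cst.
  - by apply: nearW => x; exact: cvg_ramp.
by apply/funext => n; under [RHS]eq_integral do rewrite mulr1.
Qed.

Context (dO : measure_display) (Omega : measurableType dO)
  (P : {measure set Omega -> \bar R}) (D : Omega -> R)
  (mD : measurable_fun setT D) (D0 : forall w, 0 <= D w)
  (D1 : (\int[P]_w (D w)%:E = 1)%E)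
  (nu : probability (measurableTypeR R) R) (d : nat)
  (eta : 'I_d -> Omega -> R) (meta : forall j, measurable_fun setT (eta j))
  (A : set Omega) (mA : measurable A).

(** The hypothesis is applied to ramps and both sides pass to the limit: the left one by
    [cvg_weighted_mean] with the fixed density [D], the right one as a finite product of convergent
    factors. Finiteness of [a] keeps the product continuous. *)
Lemma indep_rays_of_continuous (a : \bar R) : a \is a fin_num ->
  (forall g : 'I_d -> R -> R, (forall j, continuous (g j)) ->
    (forall j x, 0 <= g j x <= 1)%R ->
    \int[P]_w ((\1_A w * \prod_(j < d) g j (eta j w)) * D w)%R%:E
    = a * \prod_(j < d) \int[nu]_x (g j x)%:E)%E ->
  forall c : 'I_d -> R,
    (\int[P]_(w in A `&` [set w | forall j, (eta j w < c j)%R]) (D w)%:E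
     = a * \prod_(j < d) nu `]-oo, c j[%classic)%E.
Proof.
move=> afin H c.
pose G w := \1_A w * \prod_(j < d) (\1_(`]-oo, c j[%classic :
  set R) (eta j w) : R).
pose G_ n w := \1_A w * \prod_(j < d) ramp (c j) n (eta j w).
have ind01 (T : Type) (S : set T) x : 0 <= (\1_S x : R) <= 1.
  by rewrite indicE; case: (x \in _); rewrite ?lexx ?ler01.
have prod01 (x y : R) : 0 <= x <= 1 -> 0 <= y <= 1 -> 0 <= x * y <= 1.
  by move=> /andP[x0 x1] /andP[y0 y1]; rewrite mulr_ge0// mulr_ile1.
have mind j : measurable_fun setT (fun w => \1_(`]-oo, c j[%classic :
  set R) (eta j w) : R).
  by apply: (measurableT_comp _ (meta j)); apply: measurable_indic.
have L : (\int[P]_w (G_ n w * D w)%:E @[n --> \oo] --> \int[P]_w (G w * D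
  w)%:E)%E.
  apply: (@cvg_weighted_mean _ _ _ P (fun=> D)) => //.
  - move=> n; apply: measurable_funM; first exact: measurable_indic.
    apply: measurable_prod => j _; apply: (measurableT_comp _ (meta j)).
    by apply: continuous_measurable_fun; exact: continuous_ramp.
  - apply: measurable_funM; first exact: measurable_indic.
    by apply: measurable_prod => j _; exact: mind.
  - by move=> n w; apply: prod01 => //; apply: prodr_01 => j; exact: ramp01.
  - by move=> w; apply: prod01 => //; exact: prodr_01.
  - by apply: nearW => w; exact: cvg_cst.
  - apply: nearW => w; apply: cvgM; first exact: cvg_cst.
    by apply: cvg_prodr => j; exact: cvg_ramp.
have nufin X : measurable X -> nu X \is a fin_num by exact: fin_num_measure.
have rampfin j n : (\int[nu]_x (ramp (c j) n x)%:E)%E \is a fin_num.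
  rewrite ge0_fin_numE; last first.
    by apply: integral_ge0 => x _; rewrite lee_fin;
      have /andP[] := ramp01 (c j) n x.
  apply: (@le_lt_trans _ _ (\int[nu]_x (cst 1%E : _ -> \bar R) x))%E.
    apply: ge0_le_integral => //.
    - by move=> x _; rewrite lee_fin; have /andP[] := ramp01 (c j) n x.
    - apply/measurable_EFinP; apply: continuous_measurable_fun.
      exact: continuous_ramp.
    - by move=> x _; rewrite lee_fin; have /andP[] := ramp01 (c j) n x.
  by rewrite integral_cst// mul1e (le_lt_trans (probability_le1 nu _)) ?ltry.
have Rg : (a * \prod_(j < d) \int[nu]_x (ramp (c j) n x)%:E @[n --> \oo] -->
    a * \prod_(j < d) nu `]-oo, c j[%classic)%E.
  apply: cvgeZl => //.
  have -> : (\prod_(j < d) nu `]-oo, c j[%classic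
      = (\prod_(j < d) fine (nu `]-oo, c j[%classic))%R%:E)%E.
    rewrite -prod_EFin; apply: eq_bigr => j _.
    by rewrite fineK//; exact: nufin.
  have -> : (fun n => \prod_(j < d) \int[nu]_x (ramp (c j) n x)%:E)%E
      = (fun n => (\prod_(j < d) fine (\int[nu]_x (ramp (c j) n x)%:E)%E)%:E).
    apply/funext => n; rewrite -prod_EFin; apply: eq_bigr => j _.
    by rewrite fineK//; exact: rampfin.
  apply/cvg_EFin; first exact: nearW.
  apply: cvg_prodr => j; apply: fine_cvg; rewrite fineK; last exact: nufin.
  exact: cvg_prob_ramp.
have LR : (fun n => \int[P]_w (G_ n w * D w)%:E)%E =
    (fun n => a * \prod_(j < d) \int[nu]_x (ramp (c j) n x)%:E)%E.
  apply/funext => n; apply: H => j; first exact: continuous_ramp.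
  by move=> x; exact: ramp01.
rewrite LR in L; rewrite -(cvg_unique _ L Rg)//.
rewrite integral_mkcond; apply: eq_integral => w _.
rewrite patchE /G; case: ifPn => wA.
  move: wA; rewrite inE => -[wA wc].
  rewrite indicE mem_set// mul1r big1 ?mul1r// => j _.
  by rewrite indicE mem_set//= in_itv/=; exact: wc.
(* Off the set, either the indicator of [A] vanishes or some coordinate violates its ray and kills
   the product. *)
have [wA'|wA'] := boolP (w \in A); last by rewrite indicE (negPf wA') !mul0r.
have [j jP] : exists j, ~ (eta j w < c j).
  apply/existsNP => wc; move: wA; rewrite notin_setE; apply; split => //.
  by rewrite -inE.
rewrite (bigD1 j)//= [\1_(`]-oo, _[%classic) _]indicE memNset ?mul0r ?mulr0
  ?mul0r//.
Qed.

End rays.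

(** * Approximation by simple processes *)

(** This shape is the one that [epsilon_trick0] sums, here to at most 1. *)
Definition dyadic (R : realType) (m : nat) : R := 1 / (2 ^ m.+1)%:R.

Lemma dyadic_gt0 (R : realType) m : 0 < dyadic R m.
Proof. by rewrite /dyadic divr_gt0// ltr0n expn_gt0. Qed.

Lemma cvg_dyadic (R : realType) : dyadic R m @[m --> \oo] --> (0 : R).
Proof.
apply: (@squeeze_cvgr _ _ _ _ (cst 0) (@harmonic R)).
- apply: nearW => m; rewrite (ltW (dyadic_gt0 _ _))/= /dyadic /harmonic div1r.
  by rewrite lef_pV2 ?posrE ?ltr0n ?expn_gt0// ler_nat ltnW// ltn_expl.
- exact: cvg_cst.
- exact: cvg_harmonic.
Qed.

(** Borel-Cantelli: [phi m] makes the bad events of rank [m] have probability at most [dyadic R m],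
    a summable bound. The threshold is squared because [U] will bound a squared L2 distance, so that
    the distance itself falls below [dyadic R m]. *)
Lemma ae_fast_subsequence (R : realType) (dO : measure_display)
    (Omega : measurableType dO) (P : probability Omega R) (I : finType)
    (U : I -> nat -> Omega -> \bar R) :
  (forall i n, measurable_fun setT (U i n)) ->
  (forall i e, 0 < e -> P [set w | (e%:E <= U i n w)%E] @[n --> \oo] --> 0%E) ->
  exists phi : nat -> nat, \forall w \ae P, \forall m \near \oo,
    forall i, (U i (phi m) w < (dyadic R m ^+ 2)%:E)%E.
Proof.
move=> mU Ucvg.
pose bad i m n := [set w | ((dyadic R m ^+ 2)%:E <= U i n w)%E].
have mbad i m n : measurable (bad i m n).
  by have := emeasurable_fun_c_infty measurableT (mU i n) (dyadic R m ^+ 2)%:E;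
    rewrite setTI.
(* Finiteness of [I] allows one index to serve all [i], hence a common choice of indices for all
   components. *)
have /choice[phi phiP] m : exists n,
    forall i, (P (bad i m n) <= (dyadic R m)%:E)%E.
  suff /filter_ex[n nP] : \forall n \near \oo, forall i,
      (P (bad i m n) <= (dyadic R m)%:E)%E by exists n.
  apply: filter_forall => i.
  have /fine_cvgP[Pfin /cvgrPdist_lt/(_ _ (dyadic_gt0 R m)) H] :=
    Ucvg i _ (exprn_gt0 2 (dyadic_gt0 R m)).
  near=> n.
  rewrite -[P _]fineK ?lee_fin; last by near: n.
  apply: ltW; apply: le_lt_trans (ler_norm _) _.
  rewrite -normrN -[X in `|X|]add0r.
  by near: n.
exists phi.
have : \forall w \ae P, forall i, ~ lim_sup_set (fun m => bad i m (phi m)) w.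
  apply: filter_forall => i.
  exists (lim_sup_set (fun m => bad i m (phi m))); split.
  - apply: bigcap_measurable => // k _; apply: bigcup_measurable => j _.
    exact: mbad.
  - apply: lim_sup_set_cvg0 => //.
    apply: (@le_lt_trans _ _ (\sum_(m <oo) (dyadic R m)%:E)%E).
      by apply: lee_nneseries => [m _ _|m _]; [exact: measure_ge0|exact: phiP].
    by apply: le_lt_trans (epsilon_trick0 _ _) _; rewrite ?ltry.
  - by move=> w /contrapT.
apply: filterS => w wP; apply: filter_forall => i.
have /existsNP[N NP] : ~ forall n, exists2 m, (n <= m)%N & bad i m (phi m) w.
  by move=> H; apply: (wP i) => n _; have [m nm bm] := H n; exists m.
exists N => // m /= Nm; rewrite ltNge; apply/negP => bm.
by apply: NP; exists m.
Unshelve. all: by end_near.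
Qed.

(** * Square integrable functions on a bounded interval *)

Section square_integrable.
Context (R : realType).
Notation mu := (@lebesgue_measure R).

Let mitv (t : R) : @measurable _ (measurableTypeR R) `[0, t]%classic.
Proof. exact: measurable_itv. Qed.

Lemma lebesgue_itv0 (t : R) : 0 <= t -> mu `[0, t] = t%:E.
Proof.
rewrite lebesgue_measure_itv/= lte_fin le_eqVlt => /predU1P[<-|->].
  by rewrite ltxx.
by rewrite oppr0 adde0.
Qed.

Lemma integrable_cst_itv0 (t c : R) : mu.-integrable `[0, t] (EFin \o cst c).
Proof.
apply: measurable_bounded_integrable => //.
- rewrite /= lebesgue_measure_itv/=; case: ifPn => // _.
  by rewrite -EFinB ltry.
- by exists `|c|; split; [exact: num_real|move=> x cx y _; exact: ltW].
Qed.

Lemma integrable_sqr (f : R -> R) (t : R) : measurable_fun `[0, t] f ->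
  (\int[mu]_(s in `[0%R, t]) (f s ^+ 2)%:E < +oo)%E ->
  mu.-integrable `[0, t] (EFin \o (fun s => f s ^+ 2)).
Proof.
move=> mf foo; apply/integrableP; split.
  by apply/measurable_EFinP; exact: measurable_funX.
by under eq_integral do rewrite /= ger0_norm ?sqr_ge0//.
Qed.

(** [|f| <= 1 + f ^+ 2], and constants are integrable on a bounded interval. *)
Lemma integrable_of_sqr (f : R -> R) (t : R) : measurable_fun `[0, t] f ->
  (\int[mu]_(s in `[0%R, t]) (f s ^+ 2)%:E < +oo)%E ->
  mu.-integrable `[0, t] (EFin \o f).
Proof.
move=> mf foo; have i2 := integrable_sqr mf foo.
have := @le_integrable _ (measurableTypeR R) R lebesgue_measure _
  (measurable_itv `[0, t]) (EFin \o f) (EFin \o (fun s => 1 + f s ^+ 2)).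
apply.
- exact/measurable_EFinP.
- move=> x _ /=; rewrite lee_fin [leRHS]ger0_norm ?addr_ge0 ?sqr_ge0//.
  have := sqr_ge0 (`|f x| - 1); have := sqr_ge0 (`|f x|).
  rewrite -(real_normK (num_real (f x))); nra.
- exact: (integrableD (mitv _) (integrable_cst_itv0 t 1) i2).
Qed.

(* Both bounds follow from [2 |x y| <= x^2 / e + e y^2] with e the distance. *)
Lemma close_in_L2 (f g : R -> R) (T e : R) : 0 <= T -> 0 < e ->
  measurable_fun `[0, T] f -> measurable_fun `[0, T] g ->
  (\int[mu]_(s in `[0%R, T]) (f s ^+ 2)%:E < +oo)%E ->
  (\int[mu]_(s in `[0%R, T]) (g s ^+ 2)%:E < +oo)%E ->
  (\int[mu]_(s in `[0%R, T]) ((f s - g s) ^+ 2)%:E < (e ^+ 2)%:E)%E ->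
  (forall t, 0 <= t -> t <= T ->
    `|\int[mu]_(s in `[0, t]) g s - \int[mu]_(s in `[0, t]) f s| <= e * (T + 1))
  /\ `|\int[mu]_(s in `[0, T]) g s ^+ 2 - \int[mu]_(s in `[0, T]) f s ^+ 2|
     <= e * (e + 1 + \int[mu]_(s in `[0, T]) g s ^+ 2).
Proof.
move=> T0 e0 mf mg f2 g2 fg.
have mfg : measurable_fun `[0, T] (fun s => f s - g s) by exact:
  measurable_funB.
have ifg := integrable_sqr mfg (lt_trans fg (ltry _)).
have if2 := integrable_sqr mf f2; have ig2 := integrable_sqr mg g2.
have if1 := integrable_of_sqr mf f2; have ig1 := integrable_of_sqr mg g2.
set q := \int[mu]_(s in `[0, T]) (f s - g s) ^+ 2.
have q0 : 0 <= q by apply: Rintegral_ge0 => s _; exact: sqr_ge0.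
have qe : q <= e ^+ 2.
  rewrite -lee_fin /q /Rintegral fineK ?(ltW fg)//.
  by rewrite ge0_fin_numE ?(lt_trans fg (ltry _))//;
    apply: integral_ge0 => s _; rewrite lee_fin sqr_ge0.
have sub t : 0 <= t -> t <= T -> `[0, t]%classic `<=` (`[0, T]%classic : set R).
  by move=> t0 tT; apply: subset_itvl; rewrite bnd_simp.
split=> [t t0 tT|].
  have st := sub t t0 tT.
  have it (h : R -> R) : mu.-integrable `[0, T] (EFin \o h) ->
      mu.-integrable `[0, t] (EFin \o h) by apply: integrableS.
  rewrite -RintegralB//; try exact: it.
  apply: le_trans (le_normr_Rintegral _ _) _ => //.
    exact: (integrableB (mitv _) (it _ ig1) (it _ if1)).
  (* The majorant of [|f - g|]; as [q <= e ^+ 2], its integral over [[0, t]] is at most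
     [e * T + e]. *)
  have bnd : mu.-integrable `[0, t] (EFin \o (fun s =>
    e + e^-1 * (f s - g s) ^+ 2)).
    exact: (integrableD (mitv _) (integrable_cst_itv0 t e)
      (integrableZl (mitv _) e^-1 (it _ ifg))).
  apply: (@le_trans _ _ (\int[mu]_(s in `[0, t]) (e + e^-1 * (f s - g s) ^+
    2))).
    apply: le_Rintegral => //.
      apply: integrable_norm.
      exact: (integrableB (mitv _) (it _ ig1) (it _ if1)).
    move=> s _; rewrite distrC; set x := f s - g s.
    rewrite -(ler_pM2l e0) mulrDr mulrA divff ?gt_eqF// mul1r.
    rewrite -(real_normK (num_real x)).
    have := sqr_ge0 (`|x| - e); have := sqr_ge0 (`|x|); have := sqr_ge0 e; nra.
  rewrite RintegralD//; last 2 first.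
  - exact: integrable_cst_itv0.
  - exact: (integrableZl (mitv _) e^-1 (it _ ifg)).
  rewrite Rintegral_cst//= lebesgue_itv0//= RintegralZl//; last exact: it.
  rewrite mulrDr mulr1; apply: lerD; first by rewrite ler_pM2l.
  rewrite ler_pdivrMl// -expr2; apply: le_trans qe.
  apply: fine_le; last first.
  - apply: ge0_subset_integral => //.
      by apply/measurable_EFinP; exact: measurable_funX.
    by move=> s _; rewrite lee_fin sqr_ge0.
  - exact: (integrable_fin_num (mitv _) ifg).
  - exact: (integrable_fin_num (mitv _) (it _ ifg)).
rewrite -RintegralB//.
apply: le_trans (le_normr_Rintegral _ _) _ => //.
  exact: (integrableB (mitv _) ig2 if2).
have i1 : mu.-integrable `[0, T] (EFin \o (fun s =>
  (1 + e^-1) * (f s - g s) ^+ 2)).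
  exact: (integrableZl (mitv _) _ ifg).
have i2 : mu.-integrable `[0, T] (EFin \o (fun s => e * g s ^+ 2)).
  exact: (integrableZl (mitv _) _ ig2).
(* From [x^2 - y^2 = (x - y)^2 + 2 y (x - y)], the cross term being at most [(x - y)^2 / e + e y^2].
   Integration gives [(1 + 1/e) e^2] plus [e] times the integral of [g^2], which is the announced
   bound. *)
apply: (@le_trans _ _ (\int[mu]_(s in `[0, T]) ((1 + e^-1) * (f s - g s) ^+ 2 +
  e * g s ^+ 2))).
  apply: le_Rintegral => //.
  - apply: integrable_norm; exact: (integrableB (mitv _) ig2 if2).
  - exact: (integrableD (mitv _) i1 i2).
  - move=> s _; set x := f s; set y := g s.
    (* Naming the quotient leaves [nra] a polynomial problem with the single relation [ueq]. *)
    have [u uE] : exists u, u = e^-1 * (x - y) ^+ 2 by eexists.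
    have ueq : e * u = (x - y) ^+ 2 by rewrite uE mulrA divff ?gt_eqF// mul1r.
    rewrite [in leRHS]mulrDl mul1r -uE.
    have h3 := mulr_ge0 (ltW e0) (sqr_ge0 (x - y)).
    have h1 := sqr_ge0 (x - y + e * y); have h2 := sqr_ge0 (x - y - e * y).
    rewrite ler_norml; apply/andP; split; rewrite -(ler_pM2l e0); nra.
rewrite RintegralD// !RintegralZl// -/q.
set c := (X in e * X); have -> : e * (e + 1 + c) = (1 + e^-1) * e ^+ 2 + e * c.
  by field; rewrite gt_eqF.
rewrite lerD2r; apply: ler_wpM2l qe.
by rewrite addr_ge0// invr_ge0 ltW.
Qed.

End square_integrable.

(** Sections at a fixed point of [Omega] of product-measurable sets are measurable: the sets with
    this property form a sigma-algebra containing the rectangles. The section of the set given by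
    progressive measurability at time [T] is the preimage under [theta] within [[0, T]]. *)
Lemma progressive_deterministic (R : realType) (disp : measure_display)
    (Omega : measurableType disp) (T : R) (F : R -> set (set Omega))
    (theta : R -> R) :
  0 <= T ->
  progressive T F (scalars R) (fun s (_ : Omega) => theta s) ->
  measurable_fun `[0, T] theta.
Proof.
move=> T0 prog _ C mC.
have TT : T \in `[0, T] by rewrite in_itv/= T0 lexx.
have [_ /(_ C (nborel_scalars mC))] := prog T TT.
move=> GS.
pose slice (Z : set (R * Omega)) := [set s | Z (s, point)].
suff sec Z : <<s [set C0 | exists I G, [/\ measurable (I : set R), F T G
    & C0 = I `*` G]] >> Z -> measurable (slice Z).
  exact: (sec _ GS).
move=> /(_ [set Z | measurable (slice Z)]); apply; split.
  split => //=.
  - by rewrite (_ : slice _ = set0).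
  - move=> A mA /=; rewrite (_ : slice _ = ~` slice A);
      first exact: measurableC.
    by apply/seteqP; split=> s /=; [move=> []|move=> ?; split].
  - by move=> A mA /=; apply: bigcup_measurable => k _; exact: mA.
move=> _ [I [G [mI _ ->]]] /=; have [Gp|Gp] := pselect (G point).
  by rewrite (_ : slice _ = I)//; apply/seteqP; split=> s //= [].
by rewrite (_ : slice _ = set0)//; apply/seteqP; split=> s //= [].
Qed.

Section simple_error.
Context (R : realType) (disp : measure_display) (Omega : measurableType disp)
  (P : probability Omega R) (T : R) (F : R -> set (set Omega))
  (F_usual : usual_conditions P T F) (K : simple_process Omega R^o)
  (K_simple : is_simple T F (scalars R) K).

Lemma svalue_measurable k : (k < ssteps K)%N ->
  measurable_fun setT (svalue K k : Omega -> R).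
Proof.
move=> kn; have [_ _ _ /(_ _ kn)[_ sm _]] := K_simple.
have /andP[t0 tT] := stime_itv K_simple (ltnW kn).
apply: (meas_in_measurable F_usual t0 tT); apply/(meas_inP F_usual) => // C mC.
by apply: sm; exact: nborel_scalars.
Qed.

Lemma measurable_simple_val2 :
  measurable_fun setT (fun z : Omega * R => simple_val K z.2 z.1 : R).
Proof.
apply: measurable_sum => k; apply: measurable_funM.
  have mi : measurable_fun setT (\1_(`]stime K k, stime K k.+1]%classic) : R ->
    R).
    by apply: measurable_indic; exact: measurable_itv.
  exact: (measurableT_comp mi).
by apply: (measurableT_comp (svalue_measurable (ltn_ord k))).
Qed.

Lemma measurable_simple_integral (W : R -> Omega -> R) (t : R) :
  0 <= t -> t <= T ->
  (forall s, 0 <= s -> s <= T -> measurable_fun setT (W s)) ->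
  measurable_fun setT (simple_integral W K t : Omega -> R).
Proof.
move=> t0 tT mW; apply: measurable_sum => k.
have mWmin i : (i <= ssteps K)%N -> measurable_fun setT (W (Num.min (stime K i)
  t)).
  move=> ik; have /andP[s0 sT] := stime_itv K_simple ik.
  by apply: mW; [rewrite le_min s0|rewrite ge_min sT].
apply: measurable_funM; last exact: svalue_measurable (ltn_ord k).
have kn := ltn_ord k.
apply: measurable_funB; [exact: mWmin kn|exact: mWmin (ltnW kn)].
Qed.

(** Measurability in [w] comes from Tonelli for a jointly measurable integrand on the whole line;
    [theta] is first extended by zero, since it is measurable only on [[0, T]]. *)
Lemma measurable_simple_error (theta : R -> R) : measurable_fun `[0, T] theta ->
  measurable_fun setT (fun w => \int[lebesgue_measure]_(s in `[0%R, T])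
    (`|(simple_val K s w : R) - theta s| ^+ 2)%:E)%E.
Proof.
move=> mtheta.
have mth : measurable_fun setT (theta \_ `[0, T]) by
  apply/(measurable_restrictT theta) => //; exact: measurable_itv.
pose f (z : Omega * R) : \bar R :=
  (`|(simple_val K z.2 z.1 : R) - (theta \_ `[0, T]) z.2| ^+ 2
   * \1_(`[0, T]%classic : set R) z.2)%:E.
have mf : measurable_fun setT f.
  apply/measurable_EFinP; apply: measurable_funM.
    apply: measurable_funX; apply: measurableT_comp => //.
    apply: measurable_funB; first exact: measurable_simple_val2.
    exact: (measurableT_comp mth).
  have mi : measurable_fun setT (\1_(`[0, T]%classic) : R -> R).
    by apply: measurable_indic; exact: measurable_itv.
  exact: (measurableT_comp mi).
have f0 z : (0 <= f z)%E by rewrite lee_fin mulr_ge0// exprn_ge0.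
rewrite (_ : (fun w => _) = fubini_F lebesgue_measure f).
  exact: measurable_fun_fubini_tonelli_F.
apply/funext => w; rewrite /fubini_F [LHS]integral_mkcond.
suff -> : (fun s => f (w, s))
    = (fun s => (`|(simple_val K s w : R) - theta s| ^+ 2)%:E) \_ `[0, T] by [].
apply/funext => s; rewrite /f /= !patchE indicE.
by case: ifPn => _; rewrite ?mulr1// mulr0.
Qed.

End simple_error.

(** * Deterministic integrands *)

Lemma cvg_dist_le (R : realType) (u e : nat -> R) (l : R) :
  (\forall n \near \oo, `|u n - l| <= e n) -> e n @[n --> \oo] --> 0 ->
  u n @[n --> \oo] --> l.
Proof.
move=> ue e0; apply/cvgrPdist_lt => r r0; near=> n.
rewrite distrC; apply: le_lt_trans (_ : e n < r); first by near: n.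
apply: le_lt_trans (ler_norm _) _; rewrite -[X in `|X|]subr0 distrC.
by near: n; move/cvgrPdist_lt : e0; exact.
Unshelve. all: by end_near. Qed.

(** An event of full probability is inhabited. This extracts facts about the deterministic [theta]
    from statements made for almost every [w]. *)
Lemma ae_ex (R : realType) (dO : measure_display) (Omega : measurableType dO)
    (P : probability Omega R) (p : Omega -> Prop) :
  (\forall w \ae P, p w) -> exists w, p w.
Proof.
move=> [N [mN N0 sub]]; apply/not_existsP => np.
have NT : N = setT by apply/seteqP; split=> // w _; apply: sub; exact: np.
by have := @probability_setT _ _ _ P; rewrite -NT N0 => /eqP;
  rewrite eq_sym onee_eq0.
Qed.

Section deterministic_girsanov.
Context (R : realType) (disp : measure_display) (Omega : measurableType disp)
  (P : probability Omega R) (T : R) (T_gt0 : 0 < T)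
  (F : R -> set (set Omega)) (F_usual : usual_conditions P T F)
  (d : nat) (B : 'I_d -> R -> Omega -> R)
  (B_brownian : brownian_motion P T F B)
  (theta : 'I_d -> R -> R) (W : 'I_d -> R -> Omega -> R)
  (W_ito : forall j, is_ito P T F (scalars R) (B j)
     (fun s _ => theta j s) (W j)).

Let T0 : 0 <= T := ltW T_gt0.

Lemma theta_measurable j : measurable_fun `[0, T] (theta j).
Proof. by case: (W_ito j) => prog _ _ _ _;
  exact: progressive_deterministic prog. Qed.

Lemma theta_sqr j :
  (\int[lebesgue_measure]_(s in `[0%R, T]) (theta j s ^+ 2)%:E < +oo)%E.
Proof.
case: (W_ito j) => _ /ae_ex[_ +] _ _ _; congr (_ < _)%E.
by apply: eq_integral => s _; rewrite real_normK// num_real.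
Qed.

Lemma W_measurable j : measurable_fun setT (W j T).
Proof.
case: (W_ito j) => _ _ adW _ _; apply: (meas_in_measurable F_usual T0 (lexx T)).
apply/(meas_inP F_usual) => // C mC.
have TT : T \in `[0, T] by rewrite in_itv/= T0 lexx.
by have [_] := adW T TT; apply; exact: nborel_scalars.
Qed.

Let E (w : Omega) : R := expR (\sum_(j < d) (W j T w
  - 2^-1 * \int[lebesgue_measure]_(s in `[0, T]) theta j s ^+ 2)).

Lemma measurable_density : measurable_fun setT E.
Proof.
apply: (measurableT_comp (@measurable_expR R)); apply: measurable_sum => j.
by apply: measurable_funB => //; exact: W_measurable.
Qed.

Let shift j (t : R) := \int[lebesgue_measure]_(s in `[0, t]) theta j s.

(** One choice of indices makes the squared L2 errors and the errors of the stochastic integrals at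
    [T] small for all [j]. [close_in_L2] then converts the L2 error into convergence of the drifts
    and of the integrals of squares. The density needs [I] and [L] at time [T], the increments need
    [J] at every time. *)
Lemma simple_approximation :
  exists K : nat -> 'I_d -> simple_process Omega R^o,
  (forall n j, is_simple T F (scalars R) (K n j)) /\
  \forall w \ae P,
    [/\ forall j, simple_I B (K n) j T w @[n --> \oo] --> W j T w,
        forall j t, 0 <= t -> t <= T ->
          simple_J (K n) j t w @[n --> \oo] --> shift j t
      & forall j, simple_L (K n) j T w @[n --> \oo] -->
          \int[lebesgue_measure]_(s in `[0, T]) theta j s ^+ 2].
Proof.
have /choice[K KP] j : exists K : nat -> simple_process Omega R^o,
  [/\ forall n, is_simple T F (scalars R) (K n),
    forall e : R, 0 < e ->
      P [set w | (e%:E <= \int[lebesgue_measure]_(s in `[0%R, T])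
        (`|(simple_val (K n) s w : R) - theta j s| ^+ 2)%:E)%E]
      @[n --> \oo] --> 0%E
  & forall e : R, 0 < e ->
      P [set w | (e%:E <= `|(simple_integral (B j) (K n) T w :
        R) - W j T w|%:E)%E]
      @[n --> \oo] --> 0%E].
  case: (W_ito j) => _ _ _ _ [K [K1 K2 K3]]; exists K; split => //.
  move=> e e0; have := K3 T e; apply => //.
  by rewrite in_itv/= T0 lexx.
(* The disjoint sum gathers both kinds of error into one finite family, as [ae_fast_subsequence]
   expects. *)
pose U (i : 'I_d + 'I_d) (n : nat) (w : Omega) : \bar R :=
  match i with
  | inl j => (\int[lebesgue_measure]_(s in `[0%R, T])
      (`|(simple_val (K j n) s w : R) - theta j s| ^+ 2)%:E)%E
  | inr j => (`|(simple_integral (B j) (K j n) T w : R) - W j T w|%:E)%E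
  end.
have Kj j n : is_simple T F (scalars R) (K j n) by case: (KP j).
have mU i n : measurable_fun setT (U i n).
  case: i => j.
    apply: (measurable_simple_error F_usual (Kj j n)); exact: theta_measurable.
  apply/measurable_EFinP; apply: measurableT_comp => //.
  apply: measurable_funB; last exact: W_measurable.
  apply: (measurable_simple_integral F_usual (Kj j n) T0 (lexx T)) => s s0 sT.
  apply: (meas_in_measurable F_usual s0 sT).
  exact: (brownian_meas_in F_usual B_brownian).
have Ucvg i e : 0 < e -> P [set w | (e%:E <= U i n w)%E] @[n --> \oo] --> 0%E.
  by case: i => j e0 /=; case: (KP j) => _ K2 K3; [exact: K2|exact: K3].
have [phi phiP] := ae_fast_subsequence mU Ucvg.
exists (fun n j => K j (phi n)); split; first by move=> n j; exact: Kj.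
apply: filterS phiP => w wP.
have cvg1 (c : R) : dyadic R n * c @[n --> \oo] --> 0.
  by rewrite -[X in _ --> X](mul0r c); apply: cvgM;
    [exact: cvg_dyadic|exact: cvg_cst].
have close n j : (U (inl j) (phi n) w < (dyadic R n ^+ 2)%:E)%E ->
  (forall t, 0 <= t -> t <= T -> `|shift j t - simple_J (fun j =>
    K j (phi n)) j t w|
    <= dyadic R n * (T + 1)) /\
  `|\int[lebesgue_measure]_(s in `[0, T]) theta j s ^+ 2
     - simple_L (fun j => K j (phi n)) j T w|
    <= dyadic R n * (dyadic R n + 1
       + \int[lebesgue_measure]_(s in `[0, T]) theta j s ^+ 2).
  move=> Ulow; apply: close_in_L2 => //.
  - exact: dyadic_gt0.
  - by apply: measurable_funTS; exact: measurable_simple_val.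
  - exact: theta_measurable.
  - have /integrableP[_] := integrable_simple_val (K j (phi n)) 2 T w.
    congr (_ < _)%E; apply: eq_integral => s _.
    by rewrite /= ger0_norm// sqr_ge0.
  - exact: theta_sqr.
  - move: Ulow; congr (_ < _)%E.
    by apply: eq_integral => s _; rewrite real_normK// num_real.
split=> [j|j t t0 tT|j].
- apply: (@cvg_dist_le _ _ (fun n => dyadic R n * dyadic R n)).
    apply: filterS wP => n /(_ (inr j)); rewrite /= lte_fin -expr2; exact: ltW.
  by rewrite -[X in _ --> X](mul0r 0); apply: cvgM; exact: cvg_dyadic.
- apply: (@cvg_dist_le _ _ (fun n => dyadic R n * (T + 1))); last exact: cvg1.
  apply: filterS wP => n /(_ (inl j)) /close[H _]; rewrite distrC; exact: H.
- apply: (@cvg_dist_le _ _ (fun n => dyadic R n * (dyadic R n + 1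
       + \int[lebesgue_measure]_(s in `[0, T]) theta j s ^+ 2))).
    apply: filterS wP => n /(_ (inl j)) /close[_ H]; rewrite distrC; exact: H.
  rewrite -[X in _ --> X](mul0r (0 + 1
       + \int[lebesgue_measure]_(s in `[0, T]) theta j s ^+ 2)).
  apply: cvgM; first exact: cvg_dyadic.
  apply: cvgD; last exact: cvg_cst.
  by apply: cvgD; [exact: cvg_dyadic|exact: cvg_cst].
Qed.

Context (E1 : (\int[P]_w (E w)%:E = 1)%E).

Let eta s t j (w : Omega) := B j t w - shift j t - (B j s w - shift j s).

Lemma measurable_eta s t j : 0 <= s -> s <= t -> t <= T ->
  measurable_fun setT (eta s t j).
Proof.
move=> s0 st tT.
have mB r : 0 <= r -> r <= T -> measurable_fun setT (B j r).
  move=> r0 rT; apply: (meas_in_measurable F_usual r0 rT).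
  exact: (brownian_meas_in F_usual B_brownian).
by apply: measurable_funB; apply: measurable_funB => //; apply: mB => //;
  [exact: le_trans st|exact: le_trans tT].
Qed.

(** [simple_girsanov] holds for each [K n]; [cvg_weighted_mean] is used on the left with the test
    functions and on the right with the indicator of [A] alone. Continuity of [g] carries the almost
    sure convergence of the shifted increments over to the integrand, and [E1] gives the limit
    density the required mean. *)
Lemma limit_girsanov s t (A : set Omega) (g : 'I_d -> R -> R) :
  0 <= s -> s < t -> t <= T -> F s A ->
  (forall j, continuous (g j)) -> (forall j x, 0 <= g j x <= 1) ->
  (\int[P]_w ((\1_A w * \prod_(j < d) g j (eta s t j w)) * E w)%:E
   = (\int[P]_(w in A) (E w)%:E)
     * \prod_(j < d) \int[normal_prob 0 (Num.sqrt (t - s))]_x (g j x)%:E)%E.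
Proof.
move=> s0 st tT FA cg g01.
have sT : s <= T by rewrite ltW// (lt_le_trans st).
have t0 : 0 <= t by rewrite (le_trans s0)// ltW.
have mA : measurable A by exact: (filtration_measurable F_usual s0 sT).
have mg j : measurable_fun setT (g j) by exact: continuous_measurable_fun.
have [K [Ksimple Kcvg]] := simple_approximation.
pose I n := simple_I B (K n); pose J n := simple_J (K n);
  pose L n := simple_L (K n).
pose D n w := \prod_(j < d) density_incr (I n) (L n) 0 T j w.
pose S n j := shifted_incr B (J n) s t j.
have gir n r r' : 0 <= r -> r <= r' -> r' <= T ->
    girsanov_on P F B (I n) (J n) (L n) r r'.
  by apply: simple_girsanov_on; [exact: F_usual|exact: B_brownian|exact:
    Ksimple].
have mD n : measurable_fun setT (D n).
  apply: measurable_prod => j _; apply: (meas_in_measurable F_usual T0 (lexx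
    T)).
  by have [mZ _ _] := gir n 0 T (lexx 0) T0 (lexx T); exact: mZ.
have mS n j : measurable_fun setT (S n j).
  apply: (meas_in_measurable F_usual t0 tT).
  by have [_ mS _] := gir n s t s0 (ltW st) tT; exact: mS.
have D0 n w : 0 <= D n w by apply: prodr_ge0 => j _; exact: expR_ge0.
have D1 n : (\int[P]_w (D n w)%:E = 1)%E.
  rewrite -(simple_density_mean1 F_usual B_brownian (Ksimple n) T0).
  by apply: eq_integral => w _; rewrite prod_EFin.
(* Partition times are nonnegative, so truncation at time 0 collapses every increment; with [L0]
   this makes the density factor from 0 to [T] the full exponential. *)
have I0 n j w : I n j 0 w = 0.
  rewrite /I /simple_I /simple_integral big1// => k _.
  have /andP[tk _] := stime_itv (Ksimple n j) (ltnW (ltn_ord k)).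
  have /andP[tk1 _] := stime_itv (Ksimple n j) (ltn_ord k).
  by rewrite !min_r// subrr scale0r.
have L0 n j w : L n j 0 w = 0.
  by rewrite /L /simple_L set_itv1 Rintegral_set1.
have DE : \forall w \ae P, D n w @[n --> \oo] --> E w.
  apply: filterS Kcvg => w [Ic _ Lc].
  have -> : E w = \prod_(j < d) expR (W j T w
      - 2^-1 * \int[lebesgue_measure]_(s in `[0, T]) theta j s ^+ 2).
    by rewrite /E (big_morph expR (@expRD R) (@expR0 R)).
  apply: cvg_prodr => j; rewrite /density_incr.
  under eq_fun do rewrite I0 L0 !subr0.
  apply: (@cvg_comp _ _ _ _ expR); last exact: continuous_expR.
  apply: cvgB; first exact: Ic.
  by apply: cvgM; [exact: cvg_cst|exact: Lc].
have SE : \forall w \ae P, forall j, S n j w @[n --> \oo] --> eta s t j w.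
  apply: filterS Kcvg => w [_ Jc _] j.
  by apply: cvgB; apply: cvgB; [exact: cvg_cst|exact: Jc|exact: cvg_cst|exact:
    Jc].
have ind01 w : 0 <= (\1_A w : R) <= 1.
  by rewrite indicE; case: (w \in A); rewrite ?lexx ?ler01.
have prod01 w (h : 'I_d -> R) : 0 <= \1_A w * \prod_(j < d) g j (h j) <= 1.
  have /andP[a0 a1] := ind01 w.
  have /andP[p0 p1] : 0 <= \prod_(j < d) g j (h j) <= 1.
    by apply: prodr_01 => j; exact: g01.
  by rewrite mulr_ge0// mulr_ile1.
have mind : measurable_fun setT (\1_A : Omega -> R) by exact: measurable_indic.
have limG : (\int[P]_w ((\1_A w * \prod_(j < d) g j (S n j w)) * D n w)%:E
    @[n --> \oo] -->
    \int[P]_w ((\1_A w * \prod_(j < d) g j (eta s t j w)) * E w)%:E)%E.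
  apply: cvg_weighted_mean => //.
  - exact: measurable_density.
  - move=> n; apply: measurable_funM => //; apply: measurable_prod => j _.
    exact: (measurableT_comp (mg j) (mS n j)).
  - apply: measurable_funM => //; apply: measurable_prod => j _.
    exact: (measurableT_comp (mg j) (measurable_eta j s0 (ltW st) tT)).
  - by move=> w; exact: expR_ge0.
  - apply: filterS SE => w Sw; apply: cvgM; first exact: cvg_cst.
    by apply: cvg_prodr => j; apply: (cvg_comp _ _ (Sw j)); exact: cg.
have lim1 : (\int[P]_w (\1_A w * D n w)%:E @[n --> \oo] -->
    \int[P]_w (\1_A w * E w)%:E)%E.
  apply: (@cvg_weighted_mean _ _ _ P D E (fun=> \1_A)) => //.
  - exact: measurable_density.
  - by move=> w; exact: expR_ge0.
  - by apply: nearW => w; exact: cvg_cst.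
set N := normal_prob 0 (Num.sqrt (t - s)).
set c := (\prod_(j < d) \int[N]_x (g j x)%:E)%E.
(* Multiplication by [c] must be continuous for extended reals to pass to the limit in [eqn]. *)
have cfin : c \is a fin_num.
  rewrite /c; elim/big_ind: _ => // [x y|j _]; first exact: fin_numM.
  have gj0 x : (0 <= (g j x)%:E)%E by rewrite lee_fin; have /andP[] := g01 j x.
  rewrite ge0_fin_numE; last by apply: integral_ge0.
  apply: (@le_lt_trans _ _ (\int[N]_x (cst 1%E : _ -> \bar R) x))%E.
    apply: ge0_le_integral => //; first by apply/measurable_EFinP; exact: mg.
    by move=> x _; rewrite lee_fin; have /andP[] := g01 j x.
  by rewrite integral_cst// mul1e (le_lt_trans (probability_le1 N _)) ?ltry.
have eqn : (fun n => \int[P]_w ((\1_A w * \prod_(j < d) g j (S n j w)) * D n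
  w)%:E)%E
    = (fun n => \int[P]_w (\1_A w * D n w)%:E * c)%E.
  apply/funext => n.
  have H := simple_girsanov F_usual B_brownian (Ksimple n) s0 st tT FA
    (g := fun j x => (g j x)%:E).
  transitivity (\int[P]_w ((\1_A w)%:E * \prod_(j < d) (density_incr (I n) (L
    n) 0 T j w)%:E
      * \prod_(j < d) (g j (shifted_incr B (J n) s t j w))%:E))%E.
    apply: eq_integral => w _; rewrite !prod_EFin -!EFinM.
    by rewrite mulrAC.
  rewrite H//.
  - congr (_ * _)%E; apply: eq_integral => w _.
    by rewrite prod_EFin -EFinM.
  - by move=> j; apply/measurable_EFinP; exact: mg.
  - by move=> j x; rewrite lee_fin; have /andP[] := g01 j x.
rewrite eqn in limG.
rewrite (cvg_unique _ limG (cvgeZr cfin lim1))//; congr (_ * _)%E.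
rewrite [RHS]integral_mkcond; apply: eq_integral => w _.
by rewrite patchE indicE; case: ifPn => _; rewrite ?mul1r ?mul0r.
Qed.

Context (Q : {measure set Omega -> \bar R})
  (Q_density : forall A, measurable A -> Q A = (\int[P]_(w in A) (E w)%:E)%E).

Let Q1 : Q setT = 1%E.
Proof. by rewrite Q_density. Qed.

(** Restricting [Q] to [A] turns independence of [F s] into a statement about one finite measure, of
    total mass [Q A]. It holds on rays by [limit_girsanov] and [indep_rays_of_continuous], hence on
    Borel sets by [measure_indep_of_rays]. *)
Lemma girsanov_law s t (A : set Omega) (C : 'I_d -> set R) :
  0 <= s -> s < t -> t <= T -> F s A -> (forall j, measurable (C j)) ->
  (Q (A `&` [set w | forall j, C j (eta s t j w)])
   = Q A * \prod_(j < d) normal_prob 0 (Num.sqrt (t - s)) (C j))%E.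
Proof.
move=> s0 st tT FA mC.
have sT : s <= T by rewrite ltW// (lt_le_trans st).
have mA : measurable A by exact: (filtration_measurable F_usual s0 sT).
have meta j : measurable_fun setT (eta s t j) :=
  measurable_eta j s0 (ltW st) tT.
have QAfin : Q A \is a fin_num.
  rewrite ge0_fin_numE// (le_lt_trans _ (_ : 1 < +oo)%E) ?ltry//.
  by rewrite -Q1; apply: le_measure; rewrite ?inE.
have mrays (c : 'I_d -> R) : measurable [set w | forall j, eta s t j w < c j].
  rewrite (_ : [set w | _] = \bigcap_(j in [set: 'I_d])
      (eta s t j @^-1` `]-oo, c j[%classic)).
    apply: fin_bigcap_measurable => // j _.
    by rewrite -[_ @^-1` _]setTI; apply: meta.
  apply/seteqP; split=> w /= wc j; last by have := wc j Logic.I;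
    rewrite /= in_itv.
  by move=> _; rewrite /= in_itv/=; exact: wc.
have rays (c : 'I_d -> R) : (mrestr Q mA [set w | forall j,
  (eta s t j w < c j)%R]
    = mrestr Q mA setT
      * \prod_(j < d) normal_prob 0 (Num.sqrt (t - s)) `]-oo, c j[%classic)%E.
  rewrite /mrestr setTI setIC Q_density; last exact: measurableI.
  apply: (indep_rays_of_continuous measurable_density _ E1) => //.
    by move=> w; exact: expR_ge0.
  by move=> g cg g01; rewrite (limit_girsanov s0 st tT FA)// Q_density.
have Hoo : (mrestr Q mA setT < +oo)%E by rewrite /mrestr setTI -ge0_fin_numE.
have := measure_indep_of_rays (mu := mrestr Q mA) Hoo meta rays mC.
by rewrite /= /mrestr setTI setIC.
Qed.

(** [Q] is absolutely continuous with respect to [P]: an integral over a null set vanishes. *)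
Lemma ae_density (p : Omega -> Prop) :
  (\forall w \ae P, p w) -> \forall w \ae Q, p w.
Proof.
move=> [N [mN N0 sub]]; exists N; split => //.
rewrite Q_density//; apply: null_set_integral => //.
by apply/measurable_EFinP; apply: measurable_funTS; exact: measurable_density.
Qed.

(** [girsanov_law] contains both the Gaussian law and the independence. The remaining clauses are
    inherited from [B], because the shift is deterministic, continuous in time and zero at time
    0. *)
Theorem girsanov_brownian :
  brownian_motion Q T F (fun j t w => B j t w - shift j t).
Proof.
have law1 j s t (C : set R) : 0 <= s -> s < t -> t <= T -> measurable C ->
    Q [set w | C (eta s t j w)] = normal_prob 0 (Num.sqrt (t - s)) C.
  move=> s0 st tT mC.
  have sT : s <= T by rewrite ltW// (lt_le_trans st).
  (* The marginal law: the joint law with [A] the whole space and only the coordinate [j]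
     constrained. *)
  pose D i := if i == j then C else setT.
  have mD i : measurable (D i) by rewrite /D; case: ifP.
  have FT : F s setT.
    have /(sigma_algebra_id) <- := filtration_sigma F_usual s0 sT.
    exact: (@measurableT _ (g_sigma_algebraType (F s))).
  have := girsanov_law s0 st tT FT mD.
  rewrite setTI Q1 mul1e (bigD1 j)//= big1 => [|i /negPf ij]; last first.
    by rewrite /D ij; exact: (@probability_setT _ _ _ (normal_prob 0 (Num.sqrt
      (t - s)))).
  rewrite {2}/D eqxx mule1 => <-; congr (Q _); apply/seteqP; split=> w /=.
    by move=> wC i; rewrite /D; case: eqP => [->|].
  by move=> /(_ j); rewrite /D eqxx.
split.
- move=> j t C; rewrite in_itv/= => /andP[t0 tT] mC.
  have mf : meas_in (F t) (fun w => B j t w - shift j t).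
    by apply: measurable_funB => //; exact: (brownian_meas_in F_usual
      B_brownian).
  by move/(meas_inP F_usual): mf; apply.
- have [_ B0 _ _ _] := B_brownian; apply: ae_density.
  apply: filterS B0 => w B0 j; rewrite B0 /shift set_itv1 Rintegral_set1.
  by rewrite subr0.
- have [_ _ Bc _ _] := B_brownian; apply: ae_density.
  apply: filterS Bc => w Bc j.
  have sc : {within `[0, T], continuous (shift j)}.
    apply: parameterized_integral_continuous => //.
    by apply: integrable_of_sqr; [exact: theta_measurable|exact: theta_sqr].
  by move=> x; apply: cvgB; [exact: Bc|exact: sc].
- by move=> j s t C s0 st tT mC; exact: law1.
- move=> s t A C s0 st tT FA mC; rewrite girsanov_law//; congr (_ * _)%E.
  by apply: eq_bigr => j _; rewrite -(law1 j s t (C j) s0 st tT (mC j)).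
Qed.

End deterministic_girsanov.

(** [fine] of the expectation of a square is nonnegative, so the square root is undone; an infinite
    expectation would be read as 0 on both sides. *)
Lemma rms_sqr (R : realType) (disp : measure_display)
    (Omega : measurableType disp) (P : probability Omega R) (d : nat) (q : R)
    (X : R -> Omega -> sdistribution R d) (s : R) :
  rms P q X s ^+ 2 = fine 'E_P[fun w => hnorm q (X s w) ^+ 2].
Proof.
rewrite sqr_sqrtr// fine_ge0// unlock; apply: integral_ge0 => w _.
by rewrite lee_fin sqr_ge0.
Qed.

Theorem theorem3p3 (R : realType) (disp : measure_display)
    (Omega : measurableType disp) (P : probability Omega R)
    (T : R) (T_gt0 : 0 < T) (d : nat) (d_ge1 : (1 <= d)%N)
    (F : R -> set (set Omega)) (F_usual : usual_conditions P T F)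
    (B : 'I_d -> R -> Omega -> R) (B_brownian : brownian_motion P T F B)
    (p : R) (p_ge0 : 0 <= p)
    (phi : sdistribution R d) (phi_in : sobolev_set (- p) phi)
    (sigma : 'I_d -> 'I_d -> sdistribution R d)
    (sigma_in : forall i j, sobolev_set p (sigma i j))
    (b : 'I_d -> sdistribution R d) (b_in : forall i, sobolev_set p (b i))
    (sbar := fun i j rho => duality (sigma i j) (translate rho phi))
    (bbar := fun i rho => duality (b i) (translate rho phi))
    (sbar_lip : forall i j, locally_lipschitz (sbar i j))
    (bbar_lip : forall i, locally_lipschitz (bbar i))
    (Z_ex : exists Z, sde_solution P T F B sbar bbar Z)
    (Z_uniq : forall Z Z', sde_solution P T F B sbar bbar Z ->
       sde_solution P T F B sbar bbar Z' ->
       \forall w \ae P, forall t : R, t \in `[0, T] -> Z t w = Z' t w)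
    (X : R -> Omega -> sdistribution R d)
    (X_sol : spde_solution P T F B p sigma b phi X)
    (lambda : R) (lambda_gt0 : 0 < lambda)
    (X_bound : (\int[P]_w ereal_sup
        [set (hnorm (- p - 1) (X t w) ^+ 2)%:E | t in `[0%R, T]]
      <= lambda%:E)%E)
    (W : 'I_d -> R -> Omega -> R)
    (W_ito : forall j, is_ito P T F (scalars R) (B j)
       (fun s _ => rms P (- p - 1) X s) (W j))
    (density := fun w : Omega => expR (\sum_(j < d) (W j T w
       - 2^-1 * \int[lebesgue_measure]_(s in `[0, T])
                  fine 'E_P[fun w' => hnorm (- p - 1) (X s w') ^+ 2])))
    (density_mean : ('E_P[density] = 1)%E)
    (Q : {measure set Omega -> \bar R})
    (Q_density : forall A, measurable A ->
       Q A = (\int[P]_(w in A) (density w)%:E)%E) :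
  Q [set: Omega] = 1%E /\
  brownian_motion Q T F (fun j t w => B j t w
    - \int[lebesgue_measure]_(s in `[0, t]) rms P (- p - 1) X s).
Proof.
(* The exponent is written with the mean square of the norm, whereas [girsanov_brownian] expects the
   square of the integrand. *)
have densityE w : density w = expR (\sum_(j < d) (W j T w
    - 2^-1 * \int[lebesgue_measure]_(s in `[0, T]) rms P (- p - 1) X s ^+ 2)).
  rewrite /density; congr expR; apply: eq_bigr => j _; congr (_ - _ * _).
  by apply: eq_Rintegral => s _; rewrite rms_sqr.
have mean1 : (\int[P]_w (density w)%:E = 1)%E.
  by have := density_mean; rewrite unlock.
split; first by rewrite Q_density.
(* Here [theta j] is the same function [rms P (- p - 1) X] for every [j]. *)
apply: (girsanov_brownian T_gt0 F_usual B_brownian W_ito) => [|A mA].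
  by rewrite -mean1; apply: eq_integral => w _; rewrite densityE.
by rewrite (Q_density A mA); apply: eq_integral => w _; rewrite densityE.
Qed.
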